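(* The (multivalued) function $y(a,b)$ of two complex variables $a,b$ defined by the equation $y^5+ay+b=0$ cannot be expressed in terms of entire algebraic functions of a single variable by means of composition, addition and multiplication.
   Context: An entire algebraic function of a single variable $t$ is a multivalued function $\varphi(t)$ on $\mathbb{C}$ defined by an irreducible equation $\varphi^n+f_{n-1}\varphi^{n-1}+\dots+f_0=0$ whose coefficients $f_{n-1},\dots,f_0$ are polynomials in $t$ with complex coefficients (polynomials themselves are included). Expressibility: $y$ is expressed in terms of entire algebraic functions of a single variable by means of composition, addition and multiplication if there are a point $p\in\mathbb{C}^2$ and a finite sequence $g_1,\dots,g_k$ of germs of analytic functions at $p$ such that $g_k$ is a germ of $y$ at $p$ and each $g_i$ either is the germ of a coordinate function $a$ or $b$ or of a constant, or is a sum or a product of germs $g_j$, $g_l$ with $j,l<i$, or is $\varphi\circ g_j$ with $j<i$, where $\varphi$ is an analytic germ at the point $g_j(p)$ of an entire algebraic function of a single variable. *)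

(* Defs.v *)
From HB Require Import structures.
From mathcomp Require Import all_boot all_order all_algebra complex.
From mathcomp Require Import all_classical all_reals all_analysis.

Set Implicit Arguments.
Unset Strict Implicit.
Unset Printing Implicit Defensive.

Import Order.TTheory GRing.Theory Num.Theory.
Import numFieldNormedType.Exports.

Local Open Scope classical_set_scope.
Local Open Scope ring_scope.

(* MathComp-Analysis puts a topology on an abstract numClosedFieldType but not
   directly on the type R[i], so everything is defined over such a K and is
   meant to be used with K := R[i], R : realType.

   A germ at p is represented by a total function of which only the values near
   p matter; equality of germs at p is equality near p. *)

Section Germs.
Variable K : numClosedFieldType.
Implicit Types (p : K * K) (f g : K * K -> K).

Definition analytic_at (phi : K -> K) (t0 : K) : Prop :=
  exists c : nat -> K, \forall t \near t0,
    series (fun n => c n * (t - t0) ^+ n) @ \oo --> phi t.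

(* The double series converges absolutely near p (convergence of the square
   partial sums of the norms), which makes the order of summation used for its
   sum irrelevant. *)
Definition analytic_at2 f p : Prop :=
  exists c : nat -> nat -> K, \forall z \near p,
    let u i j := c i j * (z.1 - p.1) ^+ i * (z.2 - p.2) ^+ j in
    cvgn (fun n => \sum_(i < n) \sum_(j < n) `|u i j|) /\
    (fun n => \sum_(i < n) \sum_(j < n) u i j) @ \oo --> f z.

(* P is seen as a polynomial in the unknown phi (the outer variable) with
   coefficients in K[t]. irreducible_poly over the integral domain {poly K}
   uses pseudo-division, i.e. it is irreducibility in K(t)[phi]; since P is
   monic this is the same as irreducibility in K[t, phi]. *)
Definition entire_algebraic_germ (phi : K -> K) (t0 : K) : Prop :=
  analytic_at phi t0 /\
  exists P : {poly {poly K}},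
    [/\ P \is monic, irreducible_poly P &
        \forall t \near t0, P.[(phi t)%:P].[t] = 0].

Variant formation_step p (k : nat) (g : 'I_k.+1 -> K * K -> K) (i : 'I_k.+1) :
    Prop :=
  | StepFst of \forall z \near p, g i z = z.1
  | StepSnd of \forall z \near p, g i z = z.2
  | StepConst (c : K) of \forall z \near p, g i z = c
  | StepAdd (j l : 'I_k.+1) of (j < i)%N & (l < i)%N &
      \forall z \near p, g i z = g j z + g l z
  | StepMul (j l : 'I_k.+1) of (j < i)%N & (l < i)%N &
      \forall z \near p, g i z = g j z * g l z
  | StepComp (j : 'I_k.+1) (phi : K -> K) of (j < i)%N &
      entire_algebraic_germ phi (g j p) &
      \forall z \near p, g i z = phi (g j z).

(* A multivalued function is given by the relation "f is a germ of it at p". *)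
Definition expressible_by_entire_algebraic
    (is_germ_of : (K * K -> K) -> K * K -> Prop) : Prop :=
  exists (p : K * K) (k : nat) (g : 'I_k.+1 -> K * K -> K),
    [/\ forall i, analytic_at2 (g i) p,
        forall i, formation_step p g i &
        is_germ_of (g ord_max) p].

Definition germ_of_quintic_root f p : Prop :=
  analytic_at2 f p /\
  \forall z \near p, f z ^+ 5 + z.1 * f z + z.2 = 0.

End Germs.

(* Main.v *)
Require Import Defs.
From HB Require Import structures.
From mathcomp Require Import all_boot all_order all_fingroup all_algebra.
From mathcomp Require Import all_solvable all_field complex.
From mathcomp Require Import all_classical all_reals all_analysis.
From mathcomp Require Import ring.

(** Why the branches of y^5 + a y + b = 0 are out of reach.

    The obstruction is local at the origin of the (a, b)-plane.  An entire
    algebraic function phi is integral over K[t], so it stays finite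
    everywhere, and near every point c it is a power series in some root of
    t - c.  Hence any function built from such functions stays finite over the
    origin, and composing with phi near the origin only adjoins a radical to
    what has been built before: the local monodromy at the origin is solvable.
    But near the origin the five branches of y are permuted by the full
    symmetric group.  (Division would break the argument: quotients may have a
    pole or an indeterminacy at the origin.)

    The argument is carried out algebraically, over any algebraically closed
    field K with the order structure of the complex numbers.

    Restricting to the weighted curves a = t^4, b = x t^5 with x generic turns
    y into t w with w^5 + w + x = 0.  Along such a curve every function that is
    built from entire algebraic functions should be a power series in a root of
    t, whose constant term lies in K and whose coefficients are radical
    expressions in x.  Being a radical expression in x is encoded as follows:
    the coefficients lie in an extension L of K(x) on which a perfect group
    acts, and they are fixed by that group.  Such a field can be enlarged by an
    N-th root of a fixed element without losing the action and so that the new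
    root is fixed as well ([adjoin_root]), because a perfect group has no
    nontrivial characters.  Series over L with fixed coefficients and constant
    term in K are called [tame] below, and [tame_splits] says that P(h, X)
    splits over tame series when h is tame and P is monic over K[t], after
    ramifying t and enlarging L: Newton-Puiseux ([puiseux]) expands the roots of
    P(c + s, X) in roots of s, and the N-th root of h - c requires just one new
    coefficient, an N-th root of the leading coefficient of h - c.

    The starting field L is the splitting field of X^5 + X + x over K(x), with
    the alternating group A_5 acting ([quintic_gfield]).  Its construction
    needs the Galois group of this quintic to be the symmetric group S_5.  The
    five roots are realised as power series at a branch point; turning once
    around the branch point is a transposition ([monodromy_transposition]), the
    group is transitive ([relation_group_orbit]), and five is prime.  In the
    end a tame y would give a fixed root of X^5 + X + x, but A_5 moves every
    root.

    What replaces analytic continuation from the given point p to the origin is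
    elimination.  The germs g_1, ..., g_k satisfy a chain of monic polynomial
    relations, g_i being a root of a relation over K[a, b, g_1, ..., g_(i-1)].
    Taking resultants along the chain turns the equation for g_k into a
    polynomial in a and b alone that vanishes near p, so it is zero
    ([eliminate_root], [poly2_eq0_near]).  Conversely, once that polynomial is
    zero, the chain together with the equation can be solved in every domain in
    which the relations split ([norm_resultant_splits], [program_solvable]), in
    particular in tame series.  Analysis enters only through the continuity of
    the germs, which makes the relation for phi at g_j(p) a relation between
    germs at p. *)

Set Implicit Arguments.
Unset Strict Implicit.
Unset Printing Implicit Defensive.

Import Order.TTheory GRing.Theory Num.Theory.
Import numFieldNormedType.Exports.

Local Open Scope ring_scope.

(** * Formal power series *)

(** A record, so that the pointwise ring structure on functions does not
    interfere with the convolution product. *)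
Record fps (A : Type) := FPS { fcoef :> nat -> A }.

Lemma fpsP A (f g : fps A) : f =1 g -> f = g.
Proof. by case: f g => [f] [g] /= /funext ->. Qed.

HB.instance Definition _ A := gen_eqMixin (fps A).
HB.instance Definition _ A := gen_choiceMixin (fps A).

Section Ring.
Variable A : comNzRingType.
Implicit Types f g h : fps A.

Definition fps_add f g := FPS (fun n => f n + g n).
Definition fps_opp f := FPS (fun n => - f n).
Definition fps_zero : fps A := FPS (fun=> 0).

Fact fps_addA : associative fps_add.
Proof. by move=> f g h; apply: fpsP => n /=; rewrite addrA. Qed.
Fact fps_addC : commutative fps_add.
Proof. by move=> f g; apply: fpsP => n /=; rewrite addrC. Qed.
Fact fps_add0 : left_id fps_zero fps_add.
Proof. by move=> f; apply: fpsP => n /=; rewrite add0r. Qed.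
Fact fps_addN : left_inverse fps_zero fps_opp fps_add.
Proof. by move=> f; apply: fpsP => n /=; rewrite addNr. Qed.

HB.instance Definition _ :=
  GRing.isZmodule.Build (fps A) fps_addA fps_addC fps_add0 fps_addN.

Definition fps_trunc N f : {poly A} := \poly_(i < N) f i.
Definition fps_one : fps A := FPS (fun n => (n == 0)%:R).
Definition fps_mul f g := FPS (fun n => \sum_(i < n.+1) f i * g (n - i)%N).

Lemma coef_trunc N f n : (n < N)%N -> (fps_trunc N f)`_n = f n.
Proof. by move=> ltnN; rewrite coef_poly ltnN. Qed.

(** A coefficient of a product only depends on truncations, so the ring axioms
    for series are inherited from polynomials. *)
Lemma fps_mul_trunc N f g n : (n < N)%N ->
  fps_mul f g n = (fps_trunc N f * fps_trunc N g)`_n.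
Proof.
move=> ltnN; rewrite coefM; apply: eq_bigr => i _.
by rewrite !coef_trunc //; apply: leq_ltn_trans ltnN; rewrite ?leq_subr // -ltnS.
Qed.

Fact fps_mulC : commutative fps_mul.
Proof.
by move=> f g; apply: fpsP => n; rewrite !(fps_mul_trunc _ _ (ltnSn n)) mulrC.
Qed.
Fact fps_mulA : associative fps_mul.
Proof.
have key f g h n : fps_mul f (fps_mul g h) n =
  (fps_trunc n.+1 f * (fps_trunc n.+1 g * fps_trunc n.+1 h))`_n.
  rewrite coefM; apply: eq_bigr => i _; rewrite coef_trunc //.
  by rewrite (@fps_mul_trunc n.+1) // ltnS leq_subr.
move=> f g h; apply: fpsP => n.
by rewrite [fps_mul (fps_mul f g) h]fps_mulC !key mulrA mulrC.
Qed.
Fact fps_mul1 : left_id fps_one fps_mul.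
Proof.
move=> f; apply: fpsP => n /=; rewrite big_ord_recl /= mul1r subn0.
by rewrite big1 ?addr0 // => i _; rewrite mul0r.
Qed.
Fact fps_mulDl : left_distributive fps_mul fps_add.
Proof.
move=> f g h; apply: fpsP => n /=; rewrite -big_split /=.
by apply: eq_bigr => i _; rewrite mulrDl.
Qed.
Fact fps_one_neq0 : fps_one != fps_zero.
Proof. by apply/eqP => /(congr1 (fun f : fps A => f 0%N)) /eqP; rewrite /= oner_eq0. Qed.

HB.instance Definition _ := GRing.Zmodule_isComNzRing.Build (fps A)
  fps_mulA fps_mulC fps_mul1 fps_mulDl fps_one_neq0.

Lemma fps_coef1 n : (1 : fps A) n = (n == 0)%:R. Proof. by []. Qed.
Lemma fps_coefD f g n : (f + g) n = f n + g n. Proof. by []. Qed.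
Lemma fps_coefB f g n : (f - g) n = f n - g n. Proof. by []. Qed.
Lemma fps_coefM f g n : (f * g) n = \sum_(i < n.+1) f i * g (n - i)%N.
Proof. by []. Qed.
Lemma fps_coef_sum I (r : seq I) (P : pred I) (F : I -> fps A) n :
  (\sum_(i <- r | P i) F i) n = \sum_(i <- r | P i) F i n.
Proof. by elim/big_rec2: _ => // i x f _ <-. Qed.

Definition fps_const (f : fps A) := f 0%N.
Fact fps_const_zmod : zmod_morphism fps_const. Proof. by []. Qed.
Fact fps_const_monoid : monoid_morphism fps_const.
Proof. by split=> // f g; rewrite /fps_const fps_coefM big_ord1. Qed.
HB.instance Definition _ := GRing.isZmodMorphism.Build _ _ _ fps_const_zmod.
HB.instance Definition _ := GRing.isMonoidMorphism.Build _ _ _ fps_const_monoid.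

Definition fpsC (c : A) : fps A := FPS (fun n => if n == 0 then c else 0).
Lemma fpsCM c f n : (fpsC c * f) n = c * f n.
Proof.
rewrite fps_coefM big_ord_recl /= subn0 big1 ?addr0 // => i _.
by rewrite mul0r.
Qed.
Fact fpsC_zmod : zmod_morphism fpsC.
Proof. by move=> c d; apply: fpsP => -[|n]; rewrite fps_coefB /= ?subr0. Qed.
Fact fpsC_monoid : monoid_morphism fpsC.
Proof.
split; first by apply: fpsP => -[].
by move=> c d; apply: fpsP => n; rewrite fpsCM /=; case: n => //=; rewrite mulr0.
Qed.
HB.instance Definition _ := GRing.isZmodMorphism.Build _ _ _ fpsC_zmod.
HB.instance Definition _ := GRing.isMonoidMorphism.Build _ _ _ fpsC_monoid.

Definition fpsX : fps A := FPS (fun n => (n == 1)%:R).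
Lemma fpsXM f n : (fpsX * f) n = if n is m.+1 then f m else 0.
Proof.
rewrite fps_coefM; case: n => [|n]; first by rewrite big_ord1 mul0r.
rewrite !big_ord_recl /= mul0r add0r mul1r subSS subn0 big1 ?addr0 //.
by move=> i _; rewrite mul0r.
Qed.
Lemma fpsXnM k f n : (fpsX ^+ k * f) n = if (k <= n)%N then f (n - k)%N else 0.
Proof.
elim: k n => [|k IHk] n; first by rewrite mul1r subn0.
by rewrite exprS -mulrA fpsXM; case: n => // n; rewrite IHk.
Qed.
Lemma fpsXn k n : (fpsX ^+ k) n = (n == k)%:R.
Proof.
rewrite -[_ ^+ k]mulr1 fpsXnM fps_coef1 subn_eq0 eqn_leq.
by case: (leqP k n); rewrite (andbT, andbF).
Qed.

Lemma fps_divXn k f : (forall n, (n < k)%N -> f n = 0) ->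
  exists g, f = fpsX ^+ k * g /\ forall n, g n = f (n + k)%N.
Proof.
move=> f0; exists (FPS (fun n => f (n + k)%N)); split=> //; apply: fpsP => n.
by rewrite fpsXnM /=; case: leqP => [/subnK ->|/f0 ->].
Qed.

Lemma fps_expn_lt (v : fps A) k n : v 0%N = 0 -> (n < k)%N -> (v ^+ k) n = 0.
Proof.
move=> v0; have [|w [-> _]] := @fps_divXn 1 v.
  by case=> [|m]; rewrite ?v0 ?ltnS ?ltn0.
by rewrite expr1 exprMn fpsXnM ltnNge; case: leqP.
Qed.

End Ring.

Arguments fps_zero {A}.
Arguments fpsX {A}.

Section Domain.
Variable A : idomainType.

(** Every nonzero series has an order and a leading coefficient. *)
Lemma fps_ord (f : fps A) : f != 0 ->
  exists k g, f = fpsX ^+ k * g /\ g 0%N != 0.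
Proof.
move=> nzf; have [k nzk]: exists k, f k != 0.
  apply: contrapT => f0; case/eqP: nzf; apply: fpsP => n.
  by apply: contrapT => nz; apply: f0; exists n; apply/eqP.
case: (ex_minnP (ex_intro (fun k => f k != 0) k nzk)) => m nzm min_m.
have [|g [Df Dg]] := @fps_divXn _ m f.
  by move=> n; rewrite ltnNge; apply: contraNeq => /min_m.
by exists m, g; split=> //; rewrite Dg.
Qed.

Fact fps_integral (f g : fps A) : f * g = 0 -> (f == 0) || (g == 0).
Proof.
move=> fg0; apply/orP; apply: contrapT => /not_orP[/negP nzf /negP nzg].
have [k [f' [Df nzf']]] := fps_ord nzf; have [l [g' [Dg nzg']]] := fps_ord nzg.
case/negP: (mulf_neq0 nzf' nzg'); apply/eqP.
move/(congr1 (fun h : fps A => h (k + l)%N)): fg0.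
by rewrite Df Dg mulrACA -exprD fpsXnM leqnn subnn fps_coefM big_ord1.
Qed.
End Domain.

(** Inverses chosen classically make any commutative domain an [idomainType],
    even when its units have no convenient description. *)
Section ClassicalUnits.
Variable B : comNzRingType.
Definition classical_unit : pred B := fun x => `[< exists y, y * x = 1 >].
Definition classical_inv (x : B) : B :=
  if pselect (exists y, y * x = 1) is left ex then projT1 (cid ex) else x.
Lemma classical_mulVx : {in classical_unit, left_inverse 1 classical_inv *%R}.
Proof.
move=> x /asboolP Ux; rewrite /classical_inv; case: pselect => // ex.
exact: projT2 (cid ex).
Qed.
Lemma classical_unitPl (x y : B) : y * x = 1 -> classical_unit x.
Proof. by move=> yx; apply/asboolP; exists y. Qed.
Lemma classical_inv_out : {in [predC classical_unit], classical_inv =1 id}.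
Proof.
move=> x; rewrite inE /= => /asboolPn nUx; rewrite /classical_inv.
by case: pselect.
Qed.
End ClassicalUnits.

HB.instance Definition _ (A : idomainType) := GRing.ComNzRing_hasMulInverse.Build
  (fps A) (@classical_mulVx (fps A)) (@classical_unitPl (fps A))
  (@classical_inv_out (fps A)).
HB.instance Definition _ (A : idomainType) :=
  GRing.ComUnitRing_isIntegral.Build (fps A) (@fps_integral A).

Section Map.
Variables (A B : comNzRingType) (u : {rmorphism A -> B}).
Definition fps_map (f : fps A) : fps B := FPS (fun n => u (f n)).
Lemma fps_mapE f n : fps_map f n = u (f n). Proof. by []. Qed.
Fact fps_map_zmod : zmod_morphism fps_map.
Proof. by move=> f g; apply: fpsP => n; rewrite /= rmorphB. Qed.
Fact fps_map_monoid : monoid_morphism fps_map.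
Proof.
split; first by apply: fpsP => n; rewrite /= rmorph_nat.
move=> f g; apply: fpsP => n; rewrite /= rmorph_sum /=.
by apply: eq_bigr => i _; rewrite rmorphM.
Qed.
HB.instance Definition _ := GRing.isZmodMorphism.Build _ _ _ fps_map_zmod.
HB.instance Definition _ := GRing.isMonoidMorphism.Build _ _ _ fps_map_monoid.
Lemma fps_mapC c : fps_map (fpsC c) = fpsC (u c).
Proof. by apply: fpsP => -[|n] //=; rewrite rmorph0. Qed.
Lemma fps_mapX : fps_map fpsX = fpsX.
Proof. by apply: fpsP => n; rewrite /= rmorph_nat. Qed.
End Map.

(** Substitution of [v] for the variable.  Replacing [v] by [v - v(0)] makes it
    a ring morphism for every [v], so that the structure needs no side
    condition; it is the usual substitution when [v 0 = 0]. *)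
Section Comp.
Variables (A : comNzRingType) (v : fps A).
Implicit Types f g : fps A.

Let w := v - fpsC (v 0%N).
Let w0 : w 0%N = 0. Proof. by rewrite fps_coefB /= subrr. Qed.

Definition fps_comp f := FPS (fun n => \sum_(k < n.+1) f k * (w ^+ k) n).

Let horner_fps N (p : {poly A}) n : (size p <= N)%N ->
  (map_poly (@fpsC A) p).[w] n = \sum_(k < N) p`_k * (w ^+ k) n.
Proof.
move=> lepN; rewrite (@horner_coef_wide _ N) ?(leq_trans (size_poly _ _)) //.
by rewrite fps_coef_sum; apply: eq_bigr => k _; rewrite coef_map fpsCM.
Qed.

(** As [w] has no constant term, each coefficient of the result only involves
    finitely many terms, and substitution is locally polynomial evaluation. *)
Let comp_horner N (p : {poly A}) f n : (n < N)%N ->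
  (forall k, (k < N)%N -> p`_k = f k) ->
  fps_comp f n = (map_poly (@fpsC A) p).[w] n.
Proof.
move=> ltnN Dp; rewrite (@horner_fps (maxn (size p) n.+1)) ?leq_maxl //.
rewrite /= (big_ord_widen _ (fun k => f k * (w ^+ k) n) (leq_maxr (size p) n.+1)).
rewrite [RHS](bigID (fun k : 'I__ => (k < n.+1)%N)) /= [X in _ + X]big1 ?addr0.
  by apply: eq_bigr => k lekn; rewrite Dp // (leq_trans lekn).
by move=> k; rewrite -leqNgt => ltnk; rewrite fps_expn_lt ?mulr0.
Qed.

Fact fps_comp_zmod : zmod_morphism fps_comp.
Proof.
move=> f g; apply: fpsP => n; rewrite fps_coefB /= -sumrB.
by apply: eq_bigr => k _; rewrite mulrBl.
Qed.
Fact fps_comp_monoid : monoid_morphism fps_comp.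
Proof.
split.
  apply: fpsP => n; rewrite (@comp_horner n.+1 1) // ?rmorph1 ?hornerC //.
  by move=> k _; rewrite coef1.
move=> f g; apply: fpsP => n.
pose p f := fps_trunc n.+1 f.
rewrite (@comp_horner n.+1 (p f * p g)) //; last first.
  by move=> k ltkn; rewrite -fps_mul_trunc.
have Dp h k : (k <= n)%N -> (map_poly (@fpsC A) (p h)).[w] k = fps_comp h k.
  move=> lekn; symmetry; apply: (@comp_horner n.+1) => // l ltl.
  by rewrite coef_trunc.
rewrite rmorphM hornerM !fps_coefM; apply: eq_bigr => i _.
by rewrite !Dp ?leq_subr // -ltnS.
Qed.
HB.instance Definition _ := GRing.isZmodMorphism.Build _ _ _ fps_comp_zmod.
HB.instance Definition _ := GRing.isMonoidMorphism.Build _ _ _ fps_comp_monoid.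

Lemma fps_compC c : fps_comp (fpsC c) = fpsC c.
Proof.
apply: fpsP => n; rewrite (@comp_horner n.+1 c%:P) //.
  by rewrite map_polyC hornerC.
by move=> k _; rewrite coefC.
Qed.
Lemma fps_compX : v 0%N = 0 -> fps_comp fpsX = v.
Proof.
move=> v0; apply: fpsP => n; rewrite (@comp_horner n.+1 'X) //.
  by rewrite map_polyX hornerX /w v0 rmorph0 subr0.
by move=> k _; rewrite coefX.
Qed.
Lemma fps_comp0 f : fps_comp f 0%N = f 0%N.
Proof. by rewrite /= big_ord1 mulr1. Qed.
End Comp.

Lemma fps_compE (A : comNzRingType) (v f : fps A) n : v 0%N = 0 ->
  fps_comp v f n = \sum_(k < n.+1) f k * (v ^+ k) n.
Proof. by move=> v0; rewrite /= v0 rmorph0 subr0. Qed.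

Lemma fps_map_comp (A B : comNzRingType) (u : {rmorphism A -> B}) v f :
  fps_map u (fps_comp v f) = fps_comp (fps_map u v) (fps_map u f).
Proof.
apply: fpsP => n; rewrite /= rmorph_sum; apply: eq_bigr => k _ /=.
by rewrite rmorphM -fps_mapC; congr (_ * _); rewrite -fps_mapE rmorphXn rmorphB.
Qed.

(** Passing from [t] to [t ^ N], that is, expanding in an [N]-th root. *)
Section Ramify.
Variable A : comNzRingType.
Implicit Types f g : fps A.
Definition ramify N : fps A -> fps A := fps_comp (fpsX ^+ N).
HB.instance Definition _ N := GRing.RMorphism.on (ramify N).

Lemma fpsXn0 N : (0 < N)%N -> (fpsX ^+ N : fps A) 0%N = 0.
Proof. by case: N => // N _; rewrite fpsXn. Qed.

Lemma ramifyX N : (0 < N)%N -> ramify N fpsX = fpsX ^+ N.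
Proof. by move=> /fpsXn0/fps_compX. Qed.
Lemma ramifyC N c : ramify N (fpsC c) = fpsC c.
Proof. exact: fps_compC. Qed.
Lemma ramifyE N f n : (0 < N)%N ->
  ramify N f n = if (N %| n)%N then f (n %/ N)%N else 0.
Proof.
move=> N0; rewrite /ramify fps_compE ?fpsXn0 //.
under eq_bigr => k _ do rewrite -exprM fpsXn.
case: ifP => [/dvdnP[m ->] | ndvd].
  have ltm : (m < (m * N).+1)%N by rewrite ltnS leq_pmulr.
  rewrite mulnK // (bigD1 (Ordinal ltm)) //= big1 ?addr0.
    by rewrite mulnC eqxx mulr1.
  move=> k nekm; have -> : (m * N == N * k)%N = (m == k).
    by rewrite [(N * k)%N]mulnC eqn_pmul2r.
  case: eqP => [Dk|_]; last by rewrite mulr0.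
  by case/eqP: nekm; apply: val_inj.
apply: big1 => k _; case: eqP => [Dn|]; last by rewrite mulr0.
by rewrite Dn dvdn_mulr in ndvd.
Qed.
Lemma ramifyM M N f : (0 < M)%N -> (0 < N)%N ->
  ramify M (ramify N f) = ramify (N * M) f.
Proof.
move=> M0 N0; apply: fpsP => n; rewrite !ramifyE ?muln_gt0 ?N0 //.
case: (boolP (M %| n)%N) => [/dvdnP[k ->]|ndvd].
  by rewrite mulnK // dvdn_pmul2r // divnMr.
by case: ifP => // /(dvdn_trans (dvdn_mull _ (dvdnn _))); rewrite (negPf ndvd).
Qed.
End Ramify.

Lemma fps_map_ramify (A B : comNzRingType) (u : {rmorphism A -> B}) N f :
  fps_map u (ramify N f) = ramify N (fps_map u f).
Proof. by rewrite fps_map_comp rmorphXn /= fps_mapX. Qed.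

(** * Hensel's lemma and roots of series *)

Section Hensel.
Variable L : fieldType.
Implicit Types (P Q : {poly fps L}) (p q : {poly L}).

(** A polynomial with series coefficients is also a series with polynomial
    coefficients; this is its [n]-th coefficient in the latter sense. *)
Definition fps_layer n P : {poly L} := map_poly (fun f : fps L => f n) P.
Lemma coef_fps_layer n P k : (fps_layer n P)`_k = P`_k n.
Proof. by rewrite coef_map_id0. Qed.
Lemma fps_layerM n P Q :
  fps_layer n (P * Q) = \sum_(i < n.+1) fps_layer i P * fps_layer (n - i) Q.
Proof.
apply/polyP=> k; rewrite coef_fps_layer coefM fps_coef_sum coef_sum.
under [RHS]eq_bigr => i _ do rewrite coefM.
rewrite exchange_big /=; apply: eq_bigr => j _.
by apply: eq_bigr => i _; rewrite !coef_fps_layer.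
Qed.
Lemma fps_layer_inj P Q : (forall n, fps_layer n P = fps_layer n Q) -> P = Q.
Proof.
move=> ePQ; apply/polyP=> k; apply: fpsP => n.
by rewrite -!coef_fps_layer ePQ.
Qed.

Lemma course_of_values T (step : seq T -> T) :
  exists f : nat -> T, forall n, f n = step (mkseq f n).
Proof.
pose pre := fix pre n := if n is m.+1 then rcons (pre m) (step (pre m)) else [::].
have size_pre n : size (pre n) = n by elim: n => //= n IHn; rewrite size_rcons IHn.
exists (fun n => step (pre n)) => n; congr step.
by elim: n => //= n {1}->; rewrite mkseqS.
Qed.

(** The linear equation solved at each step of Hensel lifting; the bound on the
    degrees keeps the lifted factors monic. *)
Lemma bezout_small (F0 G0 c : {poly L}) : F0 \is monic -> G0 \is monic ->
    coprimep F0 G0 -> (size c < size (F0 * G0)%R)%N ->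
  exists fg : {poly L} * {poly L},
    [/\ F0 * fg.2 + fg.1 * G0 = c, (size fg.1 < size F0)%N
      & (size fg.2 < size G0)%N].
Proof.
move=> mF mG /Bezout_eq1_coprimepP[[u v] /= Duv] ltc.
have nzF := monic_neq0 mF; have nzG := monic_neq0 mG.
pose f := (v * c) %% F0; pose g := u * c + ((v * c) %/ F0) * G0.
have Dc : F0 * g + f * G0 = c.
  have Df : f = v * c - (v * c) %/ F0 * F0.
    by rewrite {1}(divp_eq (v * c) F0) addrC addKr.
  rewrite Df /g -[RHS]mul1r -Duv; ring.
have ltf : (size f < size F0)%N by rewrite ltn_modp.
exists (f, g); split=> //=.
have [-> | nzg] := eqVneq g 0; first by rewrite size_poly0 size_poly_gt0.
have sF : (0 < size F0)%N by rewrite size_poly_gt0.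
have sG : (0 < size G0)%N by rewrite size_poly_gt0.
have: (size (F0 * g)%R < size (F0 * G0)%R)%N.
  rewrite -[F0 * g](addrK (f * G0)) Dc.
  apply: leq_ltn_trans (size_polyD _ _) _; rewrite gtn_max ltc size_polyN /=.
  apply: leq_ltn_trans (size_polyMleq _ _) _; rewrite size_monicM //.
  by move: sF sG ltf; case: (size F0) => // a; case: (size G0) => // b _ _;
    rewrite !addnS /= ltnS => h; rewrite ltn_add2r.
rewrite !size_monicM //.
by move: sF sG; case: (size F0) => // a; case: (size G0) => // b _ _;
  rewrite !addSn /= ltn_add2l.
Qed.

Definition of_fps_layer d (h : nat -> {poly L}) : {poly fps L} :=
  \poly_(j < d) FPS (fun n => (h n)`_j).

Lemma fps_layerK d (h : nat -> {poly L}) n : (size (h n) <= d)%N ->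
  fps_layer n (of_fps_layer d h) = h n.
Proof.
move=> led; apply/polyP=> k; rewrite coef_fps_layer coef_poly; case: ltnP => // ledk.
by rewrite nth_default // (leq_trans led).
Qed.

Lemma monic_of_fps_layer (F0 : {poly L}) (h : nat -> {poly L}) :
  F0 \is monic -> h 0%N = F0 ->
  (forall n, (0 < n)%N -> (size (h n) < size F0)%N) ->
  of_fps_layer (size F0) h \is monic.
Proof.
move=> mF h0 hn; have sF : (0 < size F0)%N by rewrite size_poly_gt0 monic_neq0.
have lead : (of_fps_layer (size F0) h)`_(size F0).-1 = 1.
  rewrite coef_poly prednK // leqnn; apply: fpsP => -[|n] /=.
    by rewrite h0; have /monicP := mF.
  by rewrite nth_default // -ltnS prednK // hn.
have szF : size (of_fps_layer (size F0) h) = size F0.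
  apply/eqP; rewrite eqn_leq size_poly /= -[X in (X <= _)%N](prednK sF).
  by apply: contraT; rewrite -leqNgt => /leq_sizeP/(_ _ (leqnn _))/eqP;
    rewrite lead oner_eq0.
by rewrite monicE lead_coefE szF lead.
Qed.

Lemma size_fps_layer_lt P n : P \is monic -> (0 < n)%N ->
  (size (fps_layer n P) < size P)%N.
Proof.
move=> mP n0; have sP : (0 < size P)%N by rewrite size_poly_gt0 monic_neq0.
rewrite -(prednK sP) ltnS; apply/leq_sizeP => k lek; rewrite coef_fps_layer.
have [<-|nek] := eqVneq (size P).-1 k; last first.
  by rewrite nth_default // -(prednK sP) ltn_neqAle nek.
by have /monicP := mP; rewrite lead_coefE => ->; case: n n0.
Qed.

(** The layers of the factors are found one at a time: the layer of index
    [n > 0] of the product is [F0 * g_n + f_n * G0] plus terms known already. *)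
Lemma hensel P (F0 G0 : {poly L}) : P \is monic -> F0 \is monic -> G0 \is monic ->
    coprimep F0 G0 -> map_poly (@fps_const L) P = F0 * G0 ->
  exists F G, [/\ F \is monic, G \is monic, P = F * G,
    map_poly (@fps_const L) F = F0 & map_poly (@fps_const L) G = G0].
Proof.
move=> mP mF mG coFG P0.
have szP : size P = size (F0 * G0)%R.
  by rewrite -P0 size_map_poly_id0 // (monicP mP) rmorph1 oner_eq0.
(* what the known layers leave to be matched by F0 * g_n + f_n * G0 *)
pose rest n (s : seq ({poly L} * {poly L})) := fps_layer n P -
  \sum_(1 <= i < n) (nth (0, 0) s i).1 * (nth (0, 0) s (n - i)%N).2.
have solve_ex (c : {poly L}) : exists fg : {poly L} * {poly L},
    (size c < size (F0 * G0)%R)%N ->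
    [/\ F0 * fg.2 + fg.1 * G0 = c, (size fg.1 < size F0)%N
      & (size fg.2 < size G0)%N].
  case: (boolP (size c < size (F0 * G0)%R)%N) => [lec|_]; last by exists (0, 0).
  by have [fg fgP] := bezout_small mF mG coFG lec; exists fg.
have [solve solveP] := choice solve_ex.
have [h Dh] := course_of_values (fun s =>
  if size s is 0 then (F0, G0) else solve (rest (size s) s)).
have h0 : h 0%N = (F0, G0) by rewrite Dh.
have hS n : (0 < n)%N -> h n = solve (rest n (mkseq h n)).
  by case: n => // n _; rewrite Dh size_mkseq.
have restE n : rest n (mkseq h n) =
    fps_layer n P - \sum_(1 <= i < n) (h i).1 * (h (n - i)%N).2.
  congr (_ - _); apply: eq_big_nat => i /andP[i0 ltin].
  by rewrite !nth_mkseq // ltn_subrL i0 (leq_ltn_trans _ ltin).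
have small n : (0 < n)%N ->
    (size (h n).1 < size F0)%N /\ (size (h n).2 < size G0)%N /\
    F0 * (h n).2 + (h n).1 * G0 = rest n (mkseq h n).
  elim/ltn_ind: n => n IHn n0; suff /solveP: (size (rest n (mkseq h n)) <
    size (F0 * G0)%R)%N by rewrite -hS // => -[].
  rewrite restE; apply: leq_ltn_trans (size_polyD _ _) _.
  rewrite gtn_max size_polyN; apply/andP; split.
    by rewrite -szP size_fps_layer_lt.
  have B0 : (0 < size (F0 * G0)%R)%N by rewrite -szP size_poly_gt0 monic_neq0.
  rewrite big_nat_cond; apply: (big_ind (fun p => size p < size (F0 * G0)%R)%N).
  - by rewrite size_poly0.
  - move=> p q ltp ltq; apply: leq_ltn_trans (size_polyD _ _) _.
    by rewrite gtn_max ltp.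
  move=> i; rewrite andbT => /andP[i0 ltin].
  have [lt1 _] := IHn i ltin i0.
  have [||_ [lt2 _]] := IHn (n - i)%N; rewrite ?subn_gt0 ?ltn_subrL ?i0 //.
  apply: leq_ltn_trans (size_polyMleq _ _) _; rewrite size_monicM ?monic_neq0 //.
  move: lt1 lt2; case: (size F0) => // a; case: (size G0) => // b.
  rewrite !ltnS addnS addSn /= ltnS => le1 le2.
  exact: leq_trans (leq_pred _) (leq_add le1 le2).
pose f n := (h n).1; pose g n := (h n).2.
have hf n : (0 < n)%N -> (size (f n) < size F0)%N by move=> /small[].
have hg n : (0 < n)%N -> (size (g n) < size G0)%N by move=> /small[_ []].
have lef n : (size (f n) <= size F0)%N.
  by case: n => [|n]; [rewrite /f h0 | apply/ltnW/hf].
have leg n : (size (g n) <= size G0)%N.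
  by case: n => [|n]; [rewrite /g h0 | apply/ltnW/hg].
exists (of_fps_layer (size F0) f), (of_fps_layer (size G0) g); split.
- by apply: monic_of_fps_layer => //; rewrite /f h0.
- by apply: monic_of_fps_layer => //; rewrite /g h0.
- apply: fps_layer_inj => n; rewrite fps_layerM.
  under eq_bigr => i _ do rewrite !fps_layerK //.
  case: n => [|n]; first by rewrite big_ord1 /f /g h0 /= -P0.
  have [_ [_]] := small n.+1 isT; rewrite restE => Dc.
  rewrite big_ord_recl big_ord_recr /= subnn subn0 /f /g h0 /=.
  rewrite addrCA Dc addrC big_add1 big_mkord subrK //.
- by transitivity (f 0%N); [exact: fps_layerK (lef 0%N) | rewrite /f h0].
- by transitivity (g 0%N); [exact: fps_layerK (leg 0%N) | rewrite /g h0].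
Qed.
End Hensel.

Section RootOfUnit.
Variable L : fieldType.

(** Hensel's lemma for X^N - u, whose reduction has the simple root 1. *)
Lemma fps_nth_root (u : fps L) N : (0 < N)%N -> N%:R != 0 :> L -> u 0%N = 1 ->
  exists v : fps L, v 0%N = 1 /\ v ^+ N = u.
Proof.
move=> N0 nzN u0.
pose Q : {poly L} := \sum_(i < N) 'X^i.
have DX : 'X^N - 1 = ('X - 1%:P) * Q by rewrite subrX1.
have mX : ('X^N - 1 : {poly L}) \is monic by rewrite -polyC1 monicXnsubC.
have mQ : Q \is monic.
  by move: mX; rewrite DX (monicMl _ (monicXsubC 1)).
have [|||||F [G [mF mG DP F0 G0]]] := @hensel L ('X^N - u%:P) ('X - 1%:P) Q.
- by rewrite monicXnsubC.
- exact: monicXsubC.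
- exact: mQ.
- rewrite coprimep_sym coprimep_XsubC rootE /Q horner_sum.
  under eq_bigr => i _ do rewrite hornerXn expr1n.
  by rewrite sumr_const card_ord.
- by rewrite rmorphB /= map_polyXn map_polyC -DX /= /fps_const u0.
have szF : size F = 2%N.
  have : size (map_poly (@fps_const L) F) = 2%N by rewrite F0 size_XsubC.
  by rewrite size_map_poly_id0 // (monicP mF) rmorph1 oner_eq0.
have F1 : F`_1 = 1 by have /monicP := mF; rewrite lead_coefE szF.
exists (- F`_0); split.
  move/polyP: F0 => /(_ 0%N); rewrite coef_map coefB coefX coefC /fps_const /=.
  by rewrite sub0r => F00; rewrite -[RHS]opprK -F00.
have /eqP rF : F.[- F`_0] == 0.
  rewrite (@horner_coef_wide _ 2) ?szF // big_ord_recl big_ord1 /= F1.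
  by rewrite !mul1r expr0 mulr1 expr1 subrr.
have : ('X^N - u%:P).[- F`_0] = 0 by rewrite DP hornerM rF mul0r.
by rewrite !hornerE => /eqP; rewrite subr_eq0 => /eqP.
Qed.

Lemma fps_nth_root_inj (v w : fps L) N : (0 < N)%N -> N%:R != 0 :> L ->
  v 0%N = 1 -> w 0%N = 1 -> v ^+ N = w ^+ N -> v = w.
Proof.
move=> N0 nzN v0 w0 /eqP; rewrite -subr_eq0 subrXX mulf_eq0 subr_eq0.
case/orP=> [/eqP // | /eqP /(congr1 (@fps_const L))].
rewrite rmorph_sum rmorph0 (eq_bigr (fun=> 1)) => [|i _].
  by rewrite sumr_const card_ord => /eqP; rewrite (negPf nzN).
have v1 : fps_const v = 1 by []; have w1 : fps_const w = 1 by [].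
by rewrite rmorphM !rmorphXn /= v1 w1 !expr1n mul1r.
Qed.
End RootOfUnit.

(** * The Newton-Puiseux theorem *)

Section Puiseux.
Variable K : numClosedFieldType.
Implicit Types (P : {poly fps K}).

Lemma coef_XsubC_exp_pred (A : comNzRingType) (c : A) n :
  (('X - c%:P) ^+ n.+1)`_n = - c *+ n.+1.
Proof.
elim: n => [|n IHn]; first by rewrite expr1 coefB coefX coefC sub0r.
rewrite exprS mulrBl coefB coefXM coefCM IHn /=.
have := monicP (monic_exp n.+1 (monicXsubC c)).
by rewrite lead_coefE size_exp_XsubC /= => ->; rewrite mulr1 -mulrSr.
Qed.

(** Scaling all the roots by [mu] scales the coefficients by powers of [mu]. *)
Lemma coef_prod_scale (A : comNzRingType) (mu : A) (rs : seq A) j :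
  (\prod_(r <- rs) ('X - (mu * r)%:P))`_j =
    mu ^+ (size rs - j) * (\prod_(r <- rs) ('X - r%:P))`_j.
Proof.
elim: rs j => [|r rs IHrs] j.
  by rewrite !big_nil coef1; case: j => [|j]; rewrite ?mulr0 ?mul1r.
rewrite !big_cons !mulrBl !coefB !coefXM !coefCM !IHrs mulrBr /=.
have sz : size (\prod_(r <- rs) ('X - r%:P)) = (size rs).+1.
  by rewrite size_prod_XsubC.
have [lej|ltj] := leqP j (size rs).
  rewrite subSn // exprS; case: j lej => [|j] lej /=; first by rewrite mulr0; ring.
  by rewrite -(subnSK lej) exprS; ring.
rewrite [X in mu * r * (_ * X)]nth_default ?sz //.
rewrite [X in _ - mu ^+ _ * (r * X)]nth_default ?sz //.
case: j ltj => // j ltj /=; rewrite subSS; ring.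
Qed.

Definition splits P := exists rs : seq (fps K), P = \prod_(r <- rs) ('X - r%:P).

Lemma ramify_prod N (rs : seq (fps K)) :
  map_poly (ramify N) (\prod_(r <- rs) ('X - r%:P)) =
    \prod_(r <- [seq ramify N r | r <- rs]) ('X - r%:P).
Proof.
rewrite rmorph_prod big_map; apply: eq_bigr => r _.
by rewrite rmorphB /= map_polyX map_polyC.
Qed.

Lemma map_ramifyM M N P : (0 < M)%N -> (0 < N)%N ->
  map_poly (ramify M) (map_poly (ramify N) P) = map_poly (ramify (N * M)) P.
Proof.
by move=> M0 N0; apply/polyP=> j; rewrite !coef_map /= ramifyM.
Qed.

(** The second factor is only known to split after further ramification, since
    the ramification that splits the first one acts on it too. *)
Lemma splits_mul_ramify F G : 
  (exists2 N, (0 < N)%N & splits (map_poly (ramify N) F)) ->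
  (forall M, (0 < M)%N ->
    exists2 N, (0 < N)%N & splits (map_poly (ramify N) (map_poly (ramify M) G))) ->
  exists2 N, (0 < N)%N & splits (map_poly (ramify N) (F * G)).
Proof.
case=> N N0 [rs DF] /(_ N N0)[M M0 [ss DG]].
exists (N * M)%N; first by rewrite muln_gt0 N0.
exists ([seq ramify M r | r <- rs] ++ ss).
by rewrite rmorphM /= -!map_ramifyM // DF DG ramify_prod big_cat.
Qed.
End Puiseux.

Section PuiseuxTheorem.
Variable K : numClosedFieldType.
Implicit Types (P : {poly fps K}).

Lemma monic_split_top (A : nzRingType) (P : {poly A}) n : P \is monic -> size P = n.+2 ->
  P = take_poly n P + P`_n *: 'X^n + 'X^(n.+1).
Proof.
move=> /monicP mP szP; apply/polyP=> j.
rewrite !coefD coef_take_poly coefZ !coefXn.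
have [ltjn|] := ltnP j n; first by rewrite ltn_eqF // ltn_eqF ?mulr0 ?addr0 // ltnW.
rewrite leq_eqVlt => /predU1P[<-|ltnj].
  by rewrite eqxx ltn_eqF // mulr1 addr0 add0r.
rewrite (gtn_eqF ltnj) mulr0 addr0 add0r.
have [->|nej] := eqVneq j n.+1; first by rewrite -mP lead_coefE szP.
by rewrite nth_default // szP ltn_neqAle eq_sym nej.
Qed.

(** Translating by the mean of the roots kills the subleading coefficient, so
    that the polynomial cannot reduce to a power of X - c with c nonzero. *)
Lemma tschirnhaus P n : P \is monic -> size P = n.+2 ->
  exists c, [/\ P \Po ('X - c%:P) \is monic, size (P \Po ('X - c%:P)) = n.+2
    & (P \Po ('X - c%:P))`_n = 0].
Proof.
move=> mP szP; exists (fpsC n.+1%:R^-1 * P`_n); set c := _ * _.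
pose q : {poly fps K} := 'X - c%:P; rewrite -/q.
have sq k : size (q ^+ k) = k.+1 by rewrite size_exp_XsubC.
have lq k : (q ^+ k)`_k = 1.
  by have := monicP (monic_exp k (monicXsubC c)); rewrite lead_coefE sq.
have Dq : P \Po q = (take_poly n P \Po q) + P`_n *: q ^+ n + q ^+ n.+1.
  by rewrite {1}(monic_split_top mP szP) !comp_polyD comp_polyZ !comp_Xn_poly.
have st : (size (take_poly n P \Po q) <= n)%N.
  by rewrite size_comp_poly2 ?size_XsubC // size_take_poly.
have sz : size (P \Po q) = n.+2 by rewrite size_comp_poly2 ?size_XsubC.
split=> //.
  rewrite monicE lead_coefE sz Dq /= !coefD coefZ lq.
  rewrite [_`_n.+1]nth_default ?(leq_trans st) //.
  by rewrite [(q ^+ n)`_n.+1]nth_default ?sq // mulr0 !add0r.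
rewrite Dq !coefD coefZ lq [_`_n]nth_default ?(leq_trans st) // add0r mulr1.
rewrite coef_XsubC_exp_pred -mulr_natr mulNr -[_%:R](rmorph_nat (@fpsC K)) /c.
rewrite mulrAC -rmorphM mulVf ?pnatr_eq0 // rmorph1 mul1r subrr //.
Qed.

Lemma ramify_Xn q k (f : fps K) : (0 < q)%N ->
  ramify q (fpsX ^+ k * f) = fpsX ^+ (q * k) * ramify q f.
Proof. by move=> q0; rewrite rmorphM rmorphXn /= ramifyX // exprM. Qed.

(** Let r be the least order of a root, that is, the least slope ord(a_j)/(d - j).
    After ramification r is an integer, and dividing all roots by t^r gives a
    monic polynomial whose reduction is not X^d.  Taking q = d! clears the
    denominators of all slopes at once. *)
Lemma slope_normalize P d : P \is monic -> size P = d.+1 -> P != 'X^d ->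
  exists q r (P' : {poly fps K}), (0 < q)%N /\ [/\ P' \is monic, size P' = d.+1,
    forall j, (map_poly (ramify q) P)`_j = fpsX ^+ (r * (d - j)) * P'`_j,
    forall j, P`_j = 0 -> P'`_j = 0
    & exists2 j, (j < d)%N & (map_poly (@fps_const K) P')`_j != 0].
Proof.
move=> mP szP neP.
have Pd : P`_d = 1 by have /monicP := mP; rewrite lead_coefE szP.
have /choice[v /choice[b vb]] j : exists v b,
    P`_j != 0 -> P`_j = fpsX ^+ v * b /\ b 0%N != 0.
  have [->|nz] := eqVneq P`_j 0; first by exists 0%N, 0; rewrite ?eqxx.
  by have [k [g kg]] := fps_ord nz; exists k, g.
have [j1 nzj1] : exists j : 'I_d, P`_j != 0.
  apply: contrapT => allz; case/eqP: neP; apply/polyP=> j; rewrite coefXn.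
  have [ltjd|] := ltnP j d.
    rewrite ltn_eqF //; apply: contrapT => nz; apply: allz.
    by exists (Ordinal ltjd); apply/eqP.
  rewrite leq_eqVlt => /predU1P[<-|ltdj]; first by rewrite eqxx.
  by rewrite gtn_eqF // nth_default // szP.
pose q := d`!; have q0 : (0 < q)%N by rewrite fact_gt0.
pose w (j : 'I_d) := (q %/ (d - j) * v j)%N.
case: (@arg_minnP _ j1 (fun j : 'I_d => P`_j != 0) w nzj1) => j0 nzj0 min0.
pose r := w j0.
have wE (j : 'I_d) : (q * v j = w j * (d - j))%N.
  rewrite /w mulnAC divnK // dvdn_fact // subn_gt0 ltn_ord leq_subr //.
pose b' j : fps K := if P`_j == 0 then 0 else
  fpsX ^+ (q * v j - r * (d - j)) * ramify q (b j).
pose P' : {poly fps K} := \poly_(j < d.+1) if j == d then 1 else b' j.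
have P'd : P'`_d = 1 by rewrite coef_poly ltnSn eqxx.
have szP' : size P' = d.+1.
  by apply: size_poly_eq; rewrite eqxx oner_eq0.
exists q, r, P'; split=> //; split=> //.
- by rewrite monicE lead_coefE szP' P'd.
- move=> j; rewrite coef_map coef_poly ltnS.
  case: (ltngtP j d) => [ltjd|ltdj|->] /=.
  3: by rewrite Pd rmorph1 subnn muln0 mulr1.
  2: by rewrite nth_default ?szP // rmorph0 mulr0.
  rewrite /b'; case: eqP => [->|/eqP nzj]; first by rewrite rmorph0 mulr0.
  have [{1}-> _] := vb _ nzj; rewrite /= ramify_Xn // mulrA -exprD subnKC //.
  by rewrite (wE (Ordinal ltjd)) leq_mul2r min0 // orbT.
- move=> j Pj; rewrite coef_poly; case: ifP => // _.
  case: eqP => [ejd|_]; first by move/eqP: Pj; rewrite ejd Pd oner_eq0.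
  by rewrite /b' Pj eqxx.
exists j0 => //; rewrite coef_map coef_poly ltnS ltnW // ltn_eqF // /b'.
rewrite (negPf nzj0) wE subnn mul1r.
rewrite [X in X != 0](_ : _ = b j0 0%N); last exact: fps_comp0.
by have [] := vb _ nzj0.
Qed.

(** By induction on the degree.  After translation and rescaling of the roots,
    the reduction of the polynomial has at least two distinct roots: it is not
    X^d, and its subleading coefficient is zero.  Hensel's lemma then factors
    the polynomial. *)
Theorem puiseux P : P \is monic ->
  exists2 N, (0 < N)%N & splits (map_poly (ramify N) P).
Proof.
have [d] := ubnP (size P); elim: d P => // d IHd P /[!ltnS] leP mP.
case szP: (size P) => [|[|n]].
- by have := monic_neq0 mP; rewrite -size_poly_eq0 szP.
- exists 1%N => //; exists [::]; rewrite big_nil.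
  have /size1_polyC DP : (size P <= 1)%N by rewrite szP.
  have := monicP mP; rewrite DP lead_coefC => ->.
  by rewrite map_polyC /= rmorph1.
have [c [mP1 szP1 P1n]] := tschirnhaus mP szP.
set P1 := P \Po _ in mP1 szP1 P1n.
have DP : P = P1 \Po ('X + c%:P).
  by rewrite -comp_polyA comp_polyB comp_polyX comp_polyC addrK comp_polyXr.
suff [N N0 [rs Drs]] : exists2 N, (0 < N)%N & splits (map_poly (ramify N) P1).
  exists N => //; exists [seq r - ramify N c | r <- rs].
  rewrite DP map_comp_poly Drs rmorph_prod big_map; apply: eq_bigr => r _.
  rewrite /= comp_polyB comp_polyX comp_polyC rmorphD /= map_polyX map_polyC.
  by rewrite polyCB opprB addrA.
have [->|neX] := eqVneq P1 'X^(n.+1).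
  exists 1%N => //; exists (nseq n.+1 0); rewrite map_polyXn big_nseq subr0.
  by rewrite iter_mulr_1.
have [q [r [P' [q0 [mP' szP' P'E P'0 [j0 ltj0 nzj0]]]]]] :=
  slope_normalize mP1 szP1 neX.
suff [N N0 [rs Drs]] : exists2 N, (0 < N)%N & splits (map_poly (ramify N) P').
  exists (q * N)%N; first by rewrite muln_gt0 q0.
  rewrite -map_ramifyM //; exists [seq fpsX ^+ (N * r) * s | s <- rs].
  apply/polyP=> j; rewrite big_map coef_prod_scale -Drs !coef_map /= -coef_map P'E.
  rewrite ramify_Xn // mulnA exprM; congr (_ ^+ (_ - _) * _).
  have : size (map_poly (ramify N) P') = n.+2.
    by rewrite size_map_poly_id0 // (monicP mP') rmorph1 oner_eq0.
  by rewrite Drs size_prod_XsubC => -[].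
set P0 := map_poly _ P' in nzj0.
have mP0 : P0 \is monic by rewrite monic_map.
have szP0 : size P0 = n.+2.
  by rewrite size_map_poly_id0 // (monicP mP') rmorph1 oner_eq0.
have P0n : P0`_n = 0 by rewrite coef_map P'0 // rmorph0.
have [zs] := closed_field_poly_normal P0; rewrite (monicP mP0) scale1r.
case: zs => [|a zs] Dzs.
  by move: szP0; rewrite Dzs big_nil size_poly1.
(* the reduction factors into the part at the root a and the part away from a *)
pose F0 : {poly K} := \prod_(z <- a :: zs | z == a) ('X - z%:P).
pose G0 : {poly K} := \prod_(z <- a :: zs | z != a) ('X - z%:P).
have DFG : P0 = F0 * G0 by rewrite Dzs (bigID (pred1 a)).
have mF0 : F0 \is monic by apply: monic_prod => z _; exact: monicXsubC.
have mG0 : G0 \is monic by apply: monic_prod => z _; exact: monicXsubC.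
have DF0 : F0 = ('X - a%:P) ^+ (size F0).-1.
  rewrite /F0 (eq_bigr (fun=> 'X - a%:P)) => [|z /eqP->//].
  by rewrite big_const_seq iter_mulr_1 size_exp_XsubC.
have coFG : coprimep F0 G0.
  rewrite DF0 coprimep_expl // coprimep_sym coprimep_XsubC /G0.
  rewrite /root horner_prod prodf_seq_neq0.
  by apply/allP=> z _; apply/implyP; rewrite hornerXsubC subr_eq0 eq_sym.
have sF0 : (1 < size F0)%N.
  rewrite /F0 big_cons eqxx size_monicM ?monicXsubC ?monic_neq0 //; last first.
    by apply: monic_prod => z _; exact: monicXsubC.
  rewrite size_XsubC; set Q := \prod_(_ <- _ | _) _.
  have: (0 < size Q)%N.
    by rewrite size_poly_gt0 monic_neq0 // monic_prod // => z _; exact: monicXsubC.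
  by case: (size Q).
have sG0 : (1 < size G0)%N.
  rewrite ltnNge; apply/negP=> leG.
  have G1 : G0 = 1.
    by have := monicP mG0; rewrite (size1_polyC leG) lead_coefC => ->.
  move: DFG; rewrite G1 mulr1 DF0 => DP0.
  have Dn : (size F0).-1 = n.+1.
    by have := szP0; rewrite DP0 size_exp_XsubC => -[].
  rewrite Dn in DP0; move/eqP: P0n; rewrite DP0 coef_XsubC_exp_pred.
  rewrite mulrn_eq0 /= oppr_eq0 => /eqP a0.
  by move: nzj0; rewrite DP0 a0 subr0 coefXn ltn_eqF ?eqxx.
have szFG : size P0 = (size F0 + size G0).-1 by rewrite DFG size_monicM ?monic_neq0.
have [F [G [mF mG DP' F0E G0E]]] := hensel mP' mF0 mG0 coFG DFG.
have szc Q : Q \is monic -> size (map_poly (@fps_const K) Q) = size Q.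
  by move=> mQ; rewrite size_map_poly_id0 // (monicP mQ) rmorph1 oner_eq0.
have [ltF ltG] : (size F < d)%N /\ (size G < d)%N.
  rewrite -!szc // F0E G0E; move: leP; rewrite szP -szP0 szFG.
  by move: sF0 sG0; case: (size F0) => [|[|x]] // _; case: (size G0) => [|[|y]] // _;
    rewrite !addSn !addnS /= => le; split; apply: leq_trans le;
    rewrite !ltnS ?leq_addr ?leq_addl.
rewrite DP'; apply: splits_mul_ramify; first exact: IHd.
move=> M M0; apply: IHd; last exact: monic_map.
by rewrite size_map_poly_id0 // (monicP mG) rmorph1 oner_eq0.
Qed.
End PuiseuxTheorem.

(** * Elimination along a chain of monic relations *)

Section IteratedPoly.
Variable K : idomainType.

(** Polynomials in n variables, with the last variable as the outermost one:
    it is the one to be eliminated first. *)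
Fixpoint ip (n : nat) : idomainType :=
  if n is m.+1 then ({poly (ip m)} : idomainType) else K.

Fixpoint ip_var n j : ip n :=
  match n return ip n with
  | 0 => 0
  | m.+1 => if j == m then ('X : {poly ip m}) else (ip_var m j)%:P
  end.

Section Eval.
Variables (D : comNzRingType) (e0 : {rmorphism K -> D}) (env : nat -> D).

Fixpoint ev n : {rmorphism ip n -> D} :=
  match n return {rmorphism ip n -> D} with
  | 0 => e0
  | m.+1 => (horner_eval (env m) \o map_poly (ev m) : {rmorphism {poly ip m} -> D})
  end.

Lemma ev_var n j : (j < n)%N -> ev n (ip_var n j) = env j.
Proof.
elim: n => // n IHn /=; rewrite ltnS leq_eqVlt /horner_eval.
case: eqP => [-> _|_ /= ltjn]; first by rewrite map_polyX hornerX.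
by rewrite map_polyC hornerC; apply: IHn.
Qed.

Lemma evS n (Q : {poly ip n}) : ev n.+1 Q = (map_poly (ev n) Q).[env n].
Proof. by []. Qed.

End Eval.

Fixpoint ip_const n : {rmorphism K -> ip n} :=
  match n return {rmorphism K -> ip n} with
  | 0 => idfun
  | m.+1 => (@polyC (ip m) \o ip_const m : {rmorphism K -> {poly ip m}})
  end.

Lemma ev_const (D : comNzRingType) (e0 : {rmorphism K -> D}) env n c :
  ev e0 env n (ip_const n c) = e0 c.
Proof.
by elim: n => //= n IHn; rewrite /horner_eval map_polyC hornerC.
Qed.

Lemma ev_eq (D : comNzRingType) (e0 : {rmorphism K -> D}) env env' n Q :
  (forall j, (j < n)%N -> env j = env' j) -> ev e0 env n Q = ev e0 env' n Q.
Proof.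
elim: n Q => //= n IHn Q eenv; rewrite /horner_eval eenv //; congr (_.[_]).
by apply: eq_map_poly => c; apply: IHn => j ltj; rewrite eenv // ltnW.
Qed.

Lemma ev_map (D D' : comNzRingType) (e0 : {rmorphism K -> D})
    (e0' : {rmorphism K -> D'}) (u : {rmorphism D -> D'}) env n Q :
    (forall c, u (e0 c) = e0' c) ->
  u (ev e0 env n Q) = ev e0' (u \o env) n Q.
Proof.
move=> ue; elim: n Q => //= n IHn Q; rewrite /horner_eval -horner_map /= -map_poly_comp.
by congr (_.[_]); apply: eq_map_poly => c; apply: IHn.
Qed.

Lemma ev_closed (D : comNzRingType) (e0 : {rmorphism K -> D}) env
    (S : subringClosed D) n Q :
  (forall c, e0 c \in S) -> (forall j, (j < n)%N -> env j \in S) ->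
  ev e0 env n Q \in S.
Proof.
move=> Se; elim: n Q => //= n IHn Q Senv; rewrite /horner_eval rpred_horner ?Senv //.
by apply/polyOverP => j; rewrite coef_map; apply: IHn => i lti; rewrite Senv // ltnW.
Qed.

End IteratedPoly.

Section Norm.
Variables (A : idomainType) (D : idomainType) (f : {rmorphism {poly A} -> D}).
Implicit Types R Q : {poly {poly A}}.

(** Up to sign, the product of the values of [Q] at the roots of [R].  Adding a
    multiple of [R] to [Q] does not change these values and makes both arguments
    monic, so that the resultant commutes with all ring morphisms. *)
Definition norm_resultant R Q : {poly A} := resultant R (Q + 'X^(size Q) * R).

Let Q' R Q := Q + 'X^(size Q) * R.

Let monic_Q' R Q : R \is monic -> Q' R Q \is monic.
Proof.
move=> mR; rewrite monicE /Q' lead_coefDr; last first.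
  rewrite size_monicM ?monicXn ?monic_neq0 // size_polyXn addSn /=.
  by rewrite -[X in (X < _)%N]addn0 ltn_add2l size_poly_gt0 monic_neq0.
by rewrite lead_coef_monicM ?monicXn ?(monicP mR).
Qed.

Let map_norm_resultant R Q : R \is monic ->
  f (norm_resultant R Q) = resultant (map_poly f R) (map_poly f (Q' R Q)).
Proof.
move=> mR; rewrite -map_resultant // (monicP _) ?rmorph1 ?oner_eq0 //.
exact: monic_Q'.
Qed.

Let horner_Q' R Q r : root (map_poly f R) r ->
  root (map_poly f (Q' R Q)) r = root (map_poly f Q) r.
Proof.
move=> /rootP rR; rewrite /root rmorphD rmorphM hornerD hornerM rR mulr0.
by rewrite addr0.
Qed.

Lemma norm_resultant_root R Q r : R \is monic -> root (map_poly f R) r ->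
  root (map_poly f Q) r -> f (norm_resultant R Q) = 0.
Proof.
move=> mR rR rQ; apply/eqP; rewrite map_norm_resultant // resultant_eq0.
have mfR : map_poly f R \is monic by rewrite monic_map.
have: 'X - r%:P %| gcdp (map_poly f R) (map_poly f (Q' R Q)).
  by rewrite dvdp_gcd !dvdp_XsubCl horner_Q' // rR.
by move/dvdp_leq; rewrite size_XsubC gcdp_eq0 (negPf (monic_neq0 mfR)); apply.
Qed.

Lemma norm_resultant_splits R Q rs : R \is monic ->
    map_poly f R = \prod_(r <- rs) ('X - r%:P) ->
  f (norm_resultant R Q) = 0 -> exists2 r, r \in rs & root (map_poly f Q) r.
Proof.
move=> mR DR /eqP; rewrite map_norm_resultant // resultant_eq0.
set g := gcdp _ _ => sg.
have gR : g %| \prod_(r <- rs) ('X - r%:P) by rewrite -DR dvdp_gcdl.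
have [m Dg] := dvdp_prod_XsubC gR.
have [r rs_r rg]: exists2 r, r \in rs & root g r.
  case Dm: (mask m rs) => [|r s].
    by move: sg; rewrite (eqp_size Dg) Dm big_nil size_poly1.
  exists r; first by apply: (@mem_mask _ _ m); rewrite Dm mem_head.
  by rewrite (eqp_root Dg) Dm big_cons rootM root_XsubC eqxx.
move: rg; rewrite -dvdp_XsubCl => rg.
have rR : root (map_poly f R) r.
  by rewrite -dvdp_XsubCl (dvdp_trans rg) ?dvdp_gcdl.
exists r => //; rewrite -(horner_Q' _ rR).
by rewrite -dvdp_XsubCl (dvdp_trans rg) ?dvdp_gcdr.
Qed.
End Norm.

(** [R n] is a relation for the variable of index [n.+1] over the preceding ones;
    [eliminate k] removes [k] variables and keeps the first [n0.+1]. *)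
Section Elimination.
Variables (K : idomainType) (n0 : nat).
Variable R : forall n, {poly ip K n.+1}.
Hypothesis mR : forall n, R n \is monic.

Fixpoint eliminate k : ip K (k + n0).+1 -> ip K n0.+1 :=
  match k return ip K (k + n0).+1 -> ip K n0.+1 with
  | 0 => id
  | m.+1 => fun Q => @eliminate m (norm_resultant (R (m + n0)) Q)
  end.

Lemma eliminate_root (D : idomainType) (e0 : {rmorphism K -> D}) env k Q :
    (forall i, (i < k)%N ->
       root (map_poly (ev e0 env (i + n0).+1) (R (i + n0))) (env (i + n0).+1)) ->
  ev e0 env (k + n0).+1 Q = 0 -> ev e0 env n0.+1 (@eliminate k Q) = 0.
Proof.
elim: k Q => //= k IHk Q rk Q0; apply: IHk => [i ltik|]; first by rewrite rk // ltnW.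
apply: (@norm_resultant_root _ _ (ev e0 env (k + n0).+1) _ _ (env (k + n0).+1)) => //.
- exact: mR.
- exact: rk (ltnSn k).
- by apply/rootP.
Qed.

(** How to climb back up: solvability of the eliminated equation propagates to
    the original one as soon as each single relation can be solved. *)
Lemma eliminate_ind (S : forall k, ip K (k + n0).+1 -> Prop) :
    (forall k (Q : {poly ip K (k + n0).+1}),
       S k (norm_resultant (R (k + n0)) Q) -> S k.+1 Q) ->
  forall k Q, S 0%N (@eliminate k Q) -> S k Q.
Proof. by move=> SS; elim=> //= k IHk Q /IHk/SS. Qed.

End Elimination.

(** * Fields with a perfect group action *)

Section QuotientLift.
Variables (A B C : nzRingType).
Variables (pi : {rmorphism A -> B}) (phi : {rmorphism A -> C}).
Hypothesis pi_surj : forall b, exists a, pi a = b.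
Hypothesis ker_sub : forall a, pi a = 0 -> phi a = 0.

Definition quot_lift b := phi (projT1 (cid (pi_surj b))).
Lemma quot_liftE a : quot_lift (pi a) = phi a.
Proof.
rewrite /quot_lift; case: cid => a' /= Da'; apply/eqP; rewrite -subr_eq0 -rmorphB.
by rewrite ker_sub // rmorphB /= Da' subrr.
Qed.
Fact quot_lift_zmod : zmod_morphism quot_lift.
Proof.
move=> x y; have [a <-] := pi_surj x; have [b <-] := pi_surj y.
by rewrite -rmorphB !quot_liftE rmorphB.
Qed.
Fact quot_lift_monoid : monoid_morphism quot_lift.
Proof.
split; first by rewrite -(rmorph1 pi) quot_liftE rmorph1.
move=> x y; have [a <-] := pi_surj x; have [b <-] := pi_surj y.
by rewrite -rmorphM !quot_liftE rmorphM.
Qed.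
HB.instance Definition _ := GRing.isZmodMorphism.Build _ _ _ quot_lift_zmod.
HB.instance Definition _ := GRing.isMonoidMorphism.Build _ _ _ quot_lift_monoid.

Lemma rmorph_factor : exists psi : {rmorphism B -> C}, forall a, psi (pi a) = phi a.
Proof. by exists quot_lift; exact: quot_liftE. Qed.
End QuotientLift.

Lemma irreducible_factor (F : fieldType) (p : {poly F}) : (1 < size p)%N ->
  exists q, [/\ irreducible_poly q, q \is monic & q %| p].
Proof.
have [n] := ubnP (size p); elim: n p => // n IHn p /[!ltnS] lepn p1.
have nzp : p != 0 by rewrite -size_poly_gt0 ltnW.
have [irr|] := pselect (irreducible_poly p).
  have lp : (lead_coef p)^-1 != 0 by rewrite invr_eq0 lead_coef_eq0.
  exists ((lead_coef p)^-1 *: p); split.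
  - split=> [|q q1]; first by rewrite size_scale.
    rewrite dvdpZr // => /(irr.2 _ q1)/eqp_trans; apply.
    by rewrite eqp_sym eqp_scale.
  - by rewrite monicE lead_coefZ mulVf // lead_coef_eq0.
  - by rewrite dvdpZl.
move=> nirr.
have [q [q1 qp neq]] : exists q : {poly F}, [/\ size q != 1, q %| p & ~~ (q %= p)].
  apply: contrapT => nq; apply: nirr; split=> // q q1 qp.
  by apply: contrapT => /negP neq; apply: nq; exists q.
have nzq : q != 0 by apply: contraTneq qp => ->; rewrite dvd0p.
have [||r [irr mr rq]] := IHn q.
- rewrite (leq_trans _ lepn) // ltn_neqAle dvdp_leq // andbT.
  by rewrite dvdp_size_eqp.
- by rewrite ltn_neqAle eq_sym q1 size_poly_gt0.
by exists r; split=> //; apply: dvdp_trans qp.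
Qed.

Lemma poly_quotient (F : fieldType) (P : {poly F}) :
    irreducible_poly P -> P \is monic ->
  exists (E : fieldType) (pi : {rmorphism {poly F} -> E}),
    (forall x, exists q, pi q = x) /\ forall q, (pi q == 0) = (P %| q).
Proof.
move=> irr mP; pose hI : monic_irreducible_poly P := (irr, mP).
exists ({poly %/ P with hI} : fieldType).
exists (in_qpoly P : {rmorphism {poly F} -> {poly %/ P with hI}}); split.
  move=> x; exists (x : {poly F}); apply: val_inj; apply: in_qpoly_small.
  have := size_npoly x; rewrite -ltnS prednK //.
  by rewrite size_poly_gt0 monic_neq0 ?monic_mk_monic.
move=> q; rewrite -val_eqE /= mk_monicE // /dvdp.
by rewrite -Pdiv.IdomainMonic.modpE.
Qed.

(** A field over K with an action of a group by K-automorphisms.  The action is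
    a right action, in accordance with the product of permutations. *)
Record gfield (K : fieldType) (gT : finGroupType) := GField {
  gf_sort :> fieldType;
  gf_emb : {rmorphism K -> gf_sort};
  gf_act : gT -> {rmorphism gf_sort -> gf_sort};
  gf_act1 : forall x, gf_act 1%g x = x;
  gf_actM : forall g h x, gf_act (g * h)%g x = gf_act h (gf_act g x);
  gf_act_emb : forall g c, gf_act g (gf_emb c) = gf_emb c }.

Arguments gf_act {K gT} {_} _.

Definition equivariant (K : fieldType) gT (L L' : gfield K gT) (u : L -> L') :=
  (forall c, u (gf_emb L c) = gf_emb L' c) /\
  (forall g x, u (gf_act g x) = gf_act g (u x)).

Section Adjoin.
Variables (K : numClosedFieldType) (gT : finGroupType).
Hypothesis perfect : ([~: [set: gT], [set: gT]] = [set: gT])%g.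
Implicit Types L : gfield K gT.

Lemma root_of_closed_constant (E : idomainType) (u : {rmorphism K -> E})
    (p : {poly K}) x :
  p != 0 -> root (map_poly u p) x -> exists c, x = u c.
Proof.
move=> nzp; have [rs ->] := closed_field_poly_normal p.
rewrite -mul_polyC rmorphM rmorph_prod /= map_polyC /= mul_polyC rootZ; last first.
  by rewrite fmorph_eq0 lead_coef_eq0.
under eq_bigr => c _ do rewrite map_polyXsubC.
rewrite -(big_map u xpredT (fun c => 'X - c%:P)) root_prod_XsubC.
by case/mapP=> c _ ->; exists c.
Qed.

(** As K contains all roots of unity, the group acts on [y] through a character
    with values in K, and a perfect group has only the trivial one. *)
Lemma fixed_root_of_fixed L p (e y : L) : (0 < p)%N ->
  (forall g, gf_act g e = e) -> y ^+ p = e -> forall g, gf_act g y = y.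
Proof.
move=> p0 fe Dy; have [->|nzy] := eqVneq y 0; first by move=> g; rewrite rmorph0.
have zeta g : exists c, gf_act g y = gf_emb L c * y.
  have [||c Dc] := @root_of_closed_constant L (gf_emb L) ('X^p - 1%:P) (gf_act g y / y).
  - by rewrite monic_neq0 ?monicXnsubC.
  - rewrite rmorphB /= map_polyXn map_polyC /= rmorph1 /root !hornerE expr_div_n.
    by rewrite -rmorphXn Dy fe divff ?subrr // -Dy expf_neq0.
  by exists c; rewrite -Dc divfK.
pose H := [set g | gf_act g y == y].
have gH : group_set H.
  apply/group_setP; split; first by rewrite inE gf_act1.
  by move=> g h; rewrite !inE gf_actM => /eqP-> /eqP->.
have sub : ([set: gT] \subset group gH)%g.
  rewrite -perfect gen_subG; apply/fintype.subsetP => _ /imset2P[g h _ _ ->].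
  have [c Dg] := zeta g; have [d Dh] := zeta h; rewrite inE.
  have [r Dr ->] : exists2 r, (g * h = h * g * r)%g & [~ g, h]%g = r.
    by exists [~ g, h]%g => //; exact: commgC.
  have [k Dk] := zeta r.
  have Er : gf_act h (gf_act g y) = gf_act r (gf_act g (gf_act h y)).
    by rewrite -!gf_actM Dr mulgA.
  move: Er; rewrite Dg Dh !rmorphM /= !gf_act_emb Dg Dh rmorphM /= gf_act_emb Dk.
  rewrite !mulrA => E.
  have nzg c' g' : gf_act g' y = gf_emb L c' * y -> gf_emb L c' != 0.
    by move=> E'; apply: contraNneq nzy => z; rewrite z mul0r in E';
      rewrite -(fmorph_eq0 (gf_act g')) E'.
  have := mulIf nzy E => E1.
  suff -> : gf_emb L k = 1 by rewrite mul1r.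
  apply: (mulfI (mulf_neq0 (nzg _ _ Dg) (nzg _ _ Dh))).
  by rewrite mulr1 [RHS]E1 [gf_emb L c * _]mulrC.
by move=> g; have /fintype.subsetP/(_ g (finset.in_setT g)) := sub; rewrite inE => /eqP.
Qed.

(** Over a field where X^p - e splits with roots z s, z a root of unity, a factor
    of degree d has constant term z' s^d up to sign.  If 0 < d < p, then s^d and
    s^p = e generate s, so s already lies in L. *)
Lemma XnsubC_irreducible (L : fieldType) (u : {rmorphism K -> L}) p (e : L) :
  prime p -> (forall y, y ^+ p != e) -> irreducible_poly ('X^p - e%:P).
Proof.
move=> pr_p noroot; have p0 := prime_gt0 pr_p.
set P := 'X^p - e%:P; have mP : P \is monic by rewrite monicXnsubC.
have szP : size P = p.+1 by rewrite size_XnsubC.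
have nze : e != 0 by have := noroot 0; rewrite expr0n gtn_eqF // eq_sym.
split=> [|q q1 qP]; first by rewrite szP ltnS.
rewrite -dvdp_size_eqp //; apply: contrapT => /negP szq.
have nzq : q != 0 by apply: contraTneq qP => ->; rewrite dvd0p monic_neq0.
have ltq : (size q < p.+1)%N.
  by rewrite -szP ltn_neqAle szq dvdp_leq // monic_neq0.
have [|q1' [irr1 m1 q1P]] := @irreducible_factor _ P; first by rewrite szP ltnS.
have [E [pi [_ ker_pi]]] := poly_quotient irr1 m1.
pose v : {rmorphism L -> E} := pi \o polyC; pose s := pi 'X.
have sp : s ^+ p = v e.
  apply/eqP; rewrite -subr_eq0 -rmorphXn -rmorphB ker_pi; exact: q1P.
have [zs] := closed_field_poly_normal ('X^p - 1%:P : {poly K}).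
rewrite (monicP (monicXnsubC _ p0)) scale1r => Dzs.
pose w : {rmorphism K -> E} := v \o u.
have szs : size zs = p.
  have := congr1 (fun r : {poly K} => size r) Dzs.
  by rewrite /= size_XnsubC // size_prod_XsubC => -[].
have DP : map_poly v P = \prod_(r <- [seq s * w c | c <- zs]) ('X - r%:P).
  have Dw : \prod_(r <- map w zs) ('X - r%:P) = 'X^p - 1 :> {poly E}.
    rewrite big_map -(eq_bigr _ (fun c _ => map_polyXsubC w c)) -rmorph_prod -Dzs.
    by rewrite rmorphB /= map_polyXn polyC1 rmorph1.
  have -> : map_poly v P = 'X^p - (s ^+ p)%:P.
    by rewrite sp rmorphB /= map_polyXn map_polyC.
  rewrite (map_comp _ w) big_map; apply/polyP => j.
  rewrite coef_prod_scale Dw size_map szs !coefB !coefXn coefC coef1.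
  case: (eqVneq j p) => [->|nejp]; first by rewrite gtn_eqF // subnn mul1r.
  by case: j nejp => [|j] _; rewrite /= mulr0n !sub0r ?oppr0 ?mulr0 ?subn0 ?mulrN ?mulr1.
have zs0 c : c \in zs -> c != 0.
  move=> zs_c; have: root ('X^p - 1%:P) c by rewrite Dzs root_prod_XsubC.
  rewrite /root !hornerE; apply: contraTneq => ->.
  by rewrite expr0n gtn_eqF // sub0r oppr_eq0 oner_eq0.
pose q' := (lead_coef q)^-1 *: q.
have lq : (lead_coef q)^-1 != 0 by rewrite invr_eq0 lead_coef_eq0.
have mq' : q' \is monic by rewrite monicE lead_coefZ mulVf // lead_coef_eq0.
have szq' : size q' = size q by rewrite size_scale.
have := qP; rewrite -(dvdpZl _ _ lq) -/q' -(dvdp_map v) DP => q'P.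
have [m Dm] := dvdp_prod_XsubC q'P.
set ms := mask m _ in Dm.
have {}Dm : map_poly v q' = \prod_(r <- ms) ('X - r%:P).
  apply/eqP; rewrite -eqp_monic ?monic_map //.
  by apply: monic_prod => r _; exact: monicXsubC.
have sms : size ms = (size q).-1.
  have := congr1 (fun r : {poly E} => size r) Dm.
  by rewrite /= size_map_poly szq' size_prod_XsubC => ->.
have prod0 (rs : seq E) : {subset rs <= [seq s * w c | c <- zs]} ->
    exists2 c, c != 0 & (\prod_(r <- rs) ('X - r%:P)).[0] = w c * s ^+ size rs.
  elim: rs => [|r rs IHrs] sub.
    by exists 1; rewrite ?oner_eq0 // big_nil hornerE rmorph1 mulr1.
  have [|c nzc Dc] := IHrs; first by move=> x rs_x; rewrite sub // inE rs_x orbT.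
  have /mapP[d zs_d ->] := sub r (mem_head _ _).
  exists (- d * c); first by rewrite mulf_neq0 // oppr_eq0 zs0.
  by rewrite big_cons hornerM hornerXsubC Dc sub0r rmorphM rmorphN /= exprS; ring.
have [|c nzc Dc] := prod0 ms; first by move=> r; apply: mem_mask.
pose d := (size q).-1.
have [l Dl] : exists l, s ^+ d = v l.
  exists (q'`_0 / u c); rewrite fmorph_div -/(w c) -horner_coef0 -horner_map.
  rewrite rmorph0 /= Dm Dc sms mulrC mulKf //.
  by have : w c != 0 by rewrite fmorph_eq0.
have d0 : (0 < d)%N.
  by rewrite /d -subn1 subn_gt0 ltn_neqAle eq_sym q1 size_poly_gt0.
have dp : (d < p)%N by rewrite /d -ltnS prednK // size_poly_gt0.
have co : coprime p d by rewrite prime_coprime // gtnNdvd.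
(* a d = b p + 1, so s^(a d) = s e^b *)
case: (egcdnP p d0) => a b; rewrite gcdnC (eqP co) => Dab _.
have /negP := noroot (l ^+ a / e ^+ b); apply; apply/eqP/(fmorph_inj v).
transitivity (v (l ^+ a / e ^+ b) ^+ p); first exact: rmorphXn.
rewrite -sp; congr (_ ^+ p).
transitivity (v l ^+ a / v e ^+ b); first by rewrite fmorph_div !rmorphXn.
rewrite -Dl -sp -!exprM [(d * a)%N]mulnC Dab [(b * p)%N]mulnC exprD expr1.
rewrite mulrAC divff ?mul1r // expf_neq0 //.
by apply: contraNneq nze => s0; rewrite -(fmorph_eq0 v) -sp s0 expr0n gtn_eqF.
Qed.
Definition has_fixed_root L N (e : L) :=
  exists (L' : gfield K gT) (u : {rmorphism L -> L'}) (s : L'),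
    [/\ equivariant u, forall g, gf_act g s = s & s ^+ N = u e].

(** If [e] has no root in [L], then X^p - e is irreducible and fixed by the group,
    which therefore acts on L[X]/(X^p - e) and fixes the class of X.  Otherwise a
    root in [L] is fixed already. *)
Lemma adjoin_prime_root L p (e : L) : prime p ->
  (forall g, gf_act g e = e) -> has_fixed_root p e.
Proof.
move=> pr_p fe; have p0 := prime_gt0 pr_p.
have [[y Dy]|noroot] := pselect (exists y : L, y ^+ p = e).
  exists L, idfun, y; split=> //; exact: (fixed_root_of_fixed p0 fe Dy).
have irr : irreducible_poly ('X^p - e%:P).
  apply: (XnsubC_irreducible (gf_emb L)) => // y.
  by apply/eqP => Dy; apply: noroot; exists y.
have [E [pi [surj ker]]] := poly_quotient irr (monicXnsubC e p0).
have fP g : map_poly (gf_act g) ('X^p - e%:P) = 'X^p - e%:P.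
  by rewrite rmorphB /= map_polyXn map_polyC /= fe.
have /choice[psi psiP] g : exists f : {rmorphism E -> E},
    forall q, f (pi q) = pi (map_poly (gf_act g) q).
  apply: (@rmorph_factor _ _ _ pi (pi \o map_poly (gf_act g)) surj) => q /eqP.
  by rewrite ker => dvd; apply/eqP; rewrite /= ker -(fP g) dvdp_map.
have psi1 x : psi 1%g x = x.
  have [q <-] := surj x; rewrite psiP; congr (pi _); apply/polyP=> j.
  by rewrite coef_map /= gf_act1.
have psiM g h x : psi (g * h)%g x = psi h (psi g x).
  have [q <-] := surj x; rewrite !psiP; congr (pi _); apply/polyP=> j.
  by rewrite !coef_map /= gf_actM.
pose emb : {rmorphism K -> E} := pi \o (polyC \o gf_emb L).
have psi_emb g c : psi g (emb c) = emb c.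
  by rewrite /= psiP map_polyC /= gf_act_emb.
exists (GField psi1 psiM psi_emb), (pi \o polyC), (pi 'X); split.
- by split=> //= g x; rewrite psiP map_polyC.
- by move=> g /=; rewrite psiP map_polyX.
- by apply/eqP; rewrite -subr_eq0 /= -rmorphXn -rmorphB ker.
Qed.

Lemma adjoin_root L N (e : L) : (0 < N)%N ->
  (forall g, gf_act g e = e) -> has_fixed_root N e.
Proof.
have [n] := ubnP N; elim: n => // n IHn in N L e * => /[!ltnS] leNn N0 fe.
have [N1|N1] := leqP N 1.
  have -> : N = 1%N by apply/eqP; rewrite eqn_leq N1.
  by exists L, idfun, e.
have pr_p := pdiv_prime N1; set p := pdiv N in pr_p.
have [L1 [u1 [s1 [eq1 fs1 Ds1]]]] := adjoin_prime_root pr_p fe.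
have DN : N = (N %/ p * p)%N by rewrite divnK // pdiv_dvd.
have [|||L2 [u2 [s2 [eq2 fs2 Ds2]]]] := IHn (N %/ p)%N L1 s1.
- by rewrite (leq_trans _ leNn) // ltn_Pdiv // prime_gt1.
- by rewrite divn_gt0 ?prime_gt0 // dvdn_leq // pdiv_dvd.
- exact: fs1.
exists L2, (u2 \o u1), s2; split=> //.
- case: eq1 eq2 => [e1 a1] [e2 a2]; split=> [c|g x] /=; first by rewrite e1 e2.
  by rewrite a1 a2.
- by rewrite DN exprM Ds2 -rmorphXn Ds1.
Qed.
End Adjoin.

(** * Fields of fractions and morphisms between them *)

(** As [pi] and [chi] have the same kernel, sending pi a / pi b to chi a / chi b
    is well defined, whichever fraction [frac_lift] picks. *)
Section FracLift.
Variables (A : comNzRingType) (L F : fieldType).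
Variables (pi : {rmorphism A -> L}) (chi : {rmorphism A -> F}).
Hypothesis gen : forall x, exists ab : A * A, pi ab.2 != 0 /\ x = pi ab.1 / pi ab.2.
Hypothesis ker : forall a, (pi a == 0) = (chi a == 0).

Definition frac_lift x := let ab := projT1 (cid (gen x)) in chi ab.1 / chi ab.2.
Let liftE a b : pi b != 0 -> frac_lift (pi a / pi b) = chi a / chi b.
Proof.
move=> nzb; rewrite /frac_lift; case: cid => -[c d] /= [nzd E].
apply/eqP; rewrite eqr_div -?ker // -subr_eq0 -!rmorphM -rmorphB -ker.
rewrite rmorphB !rmorphM subr_eq0 -eqr_div //; exact/eqP.
Qed.
Fact frac_lift_zmod : zmod_morphism frac_lift.
Proof.
move=> x y; have [[a b] /= [nzb ->]] := gen x; have [[c d] /= [nzd ->]] := gen y.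
have E : pi a / pi b - pi c / pi d = pi (a * d - c * b) / pi (b * d).
  by rewrite -mulNr addf_div // mulNr -!rmorphM -rmorphB.
have cb : chi b != 0 by rewrite -ker.
have cd : chi d != 0 by rewrite -ker.
rewrite E !liftE // ?rmorphM ?mulf_neq0 // rmorphB !rmorphM.
by rewrite -[in RHS]mulNr addf_div // mulNr.
Qed.
Fact frac_lift_monoid : monoid_morphism frac_lift.
Proof.
split.
  have E1 : pi 1 / pi 1 = 1 by rewrite rmorph1 divr1.
  by rewrite -E1 liftE ?rmorph1 ?oner_neq0 // divr1.
move=> x y; have [[a b] /= [nzb ->]] := gen x; have [[c d] /= [nzd ->]] := gen y.
rewrite mulf_div -!rmorphM !liftE // ?rmorphM ?mulf_neq0 //.
by rewrite mulf_div.
Qed.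
HB.instance Definition _ := GRing.isZmodMorphism.Build _ _ _ frac_lift_zmod.
HB.instance Definition _ := GRing.isMonoidMorphism.Build _ _ _ frac_lift_monoid.

Lemma rmorph_frac : exists psi : {rmorphism L -> F}, forall a, psi (pi a) = chi a.
Proof.
exists frac_lift => a /=.
have -> : pi a = pi a / pi 1 by rewrite rmorph1 divr1.
by rewrite liftE ?rmorph1 ?oner_neq0 // divr1.
Qed.
End FracLift.

Lemma fractionE (B : idomainType) (x : {fraction B}) :
  exists nd : B * B, nd.2 != 0 /\ x = FracField.tofrac nd.1 / FracField.tofrac nd.2.
Proof.
elim/quotW: x => r; have nzd := denom_ratioP r.
exists ((frac r).1, (frac r).2); split=> //=.
apply: (mulIf (_ : FracField.tofrac (frac r).2 != 0)); first by rewrite tofrac_eq0.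
rewrite divfK ?tofrac_eq0 //.
unlock FracField.tofrac; rewrite -[LHS]FracField.pi_mul; apply/eqmodP.
rewrite /= FracField.equivfE /FracField.mulf.
by rewrite !numden_Ratio ?oner_neq0 ?mulr1 ?mul1r // mulrC.
Qed.

(** The image of a morphism to a domain is a domain, whose field of fractions is
    the field of [image_field]. *)
Section Image.
Variables (A : comNzRingType) (D : idomainType) (phi : {rmorphism A -> D}).
Definition in_image : {pred D} := fun d => `[< exists a, phi a = d >].
Fact in_image_subring : subring_closed in_image.
Proof.
split.
- by apply/asboolP; exists 1; rewrite rmorph1.
- move=> _ _ /asboolP[a <-] /asboolP[b <-]; apply/asboolP.
  by exists (a - b); rewrite rmorphB.
- move=> _ _ /asboolP[a <-] /asboolP[b <-]; apply/asboolP.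
  by exists (a * b); rewrite rmorphM.
Qed.
HB.instance Definition _ := GRing.isSubringClosed.Build D in_image in_image_subring.
Record image_ring := ImageRing { image_val :> D; image_valP : image_val \in in_image }.
HB.instance Definition _ := [isSub for image_val].
HB.instance Definition _ := [Choice of image_ring by <:].
HB.instance Definition _ := [SubChoice_isSubComNzRing of image_ring by <:].
HB.instance Definition _ := GRing.ComNzRing_hasMulInverse.Build
  image_ring (@classical_mulVx image_ring) (@classical_unitPl image_ring)
  (@classical_inv_out image_ring).
Fact image_integral (x y : image_ring) : x * y = 0 -> (x == 0) || (y == 0).
Proof.
move/(congr1 val); rewrite rmorphM rmorph0 => /eqP; rewrite mulf_eq0.
by rewrite -!(rmorph0 (val : image_ring -> D)) !val_eqE.
Qed.
HB.instance Definition _ := GRing.ComUnitRing_isIntegral.Build image_ring image_integral.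

Definition to_image a : image_ring :=
  ImageRing (introT (asboolP _) (ex_intro (fun b => phi b = phi a) a erefl)).
Fact to_image_zmod : zmod_morphism to_image.
Proof. by move=> a b; apply: val_inj; rewrite /= rmorphB. Qed.
Fact to_image_monoid : monoid_morphism to_image.
Proof.
by split=> [|a b]; apply: val_inj; rewrite /= ?rmorph1 ?rmorphM.
Qed.
HB.instance Definition _ := GRing.isZmodMorphism.Build _ _ _ to_image_zmod.
HB.instance Definition _ := GRing.isMonoidMorphism.Build _ _ _ to_image_monoid.

Lemma image_field : exists (L : fieldType) (pi : {rmorphism A -> L}),
  (forall x, exists ab : A * A, pi ab.2 != 0 /\ x = pi ab.1 / pi ab.2) /\
  (forall a, (pi a == 0) = (phi a == 0)).
Proof.
have surj (b : image_ring) : exists a, to_image a = b.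
  by have /asboolP[a Da] := image_valP b; exists a; apply: val_inj.
exists ({fraction image_ring} : fieldType).
exists (@FracField.tofrac image_ring \o to_image); split.
  move=> x; have [[n d] /= [nzd ->]] := fractionE x.
  have [[a Da] [b Db]] := (surj n, surj d).
  by exists (a, b); rewrite /= Da Db tofrac_eq0.
by move=> a; rewrite /= tofrac_eq0 -val_eqE.
Qed.
End Image.

(** * The quintic X^5 + X + x near a branch point *)

Section QuinticOverPoint.
Variable K : numClosedFieldType.

Lemma deriv_prod_XsubC (A : comNzRingType) (I : finType) (w : I -> A) i :
  (\prod_j ('X - (w j)%:P))^`().[w i] = \prod_(j | j != i) (w i - w j).
Proof.
rewrite (bigD1 i) //= derivM derivXsubC mul1r hornerD hornerM hornerXsubC subrr.
by rewrite mul0r addr0 horner_prod; apply: eq_bigr => j _; rewrite hornerXsubC.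
Qed.

Definition quintic (A : nzRingType) (x : A) : {poly A} := 'X^5 + 'X + x%:P.

Lemma size_quintic (A : nzRingType) (x : A) : size (quintic x) = 6%N.
Proof.
have sX : (size ('X + x%:P : {poly A})%R < size ('X^5 : {poly A}))%N.
  by rewrite size_XaddC size_polyXn.
by rewrite /quintic -addrA size_polyDl // size_polyXn.
Qed.

Lemma quintic_monic (A : nzRingType) (x : A) : quintic x \is monic.
Proof.
rewrite monicE lead_coefE size_quintic /= !coefD coefXn coefX coefC /=.
by rewrite !addr0.
Qed.

Lemma map_quintic (A B : nzRingType) (u : {rmorphism A -> B}) x :
  map_poly u (quintic x) = quintic (u x).
Proof. by rewrite !rmorphD /= map_polyXn map_polyX map_polyC. Qed.

Lemma horner_quintic (A : comNzRingType) (x y : A) :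
  (quintic x).[y] = y ^+ 5 + y + x.
Proof. by rewrite !hornerE. Qed.

Lemma deriv_quintic (A : comNzRingType) (x y : A) :
  (quintic x)^`().[y] = 5%:R * y ^+ 4 + 1.
Proof.
rewrite /quintic !derivD derivXn derivX derivC addr0 hornerD hornerMn hornerXn.
by rewrite hornerC mulr_natl.
Qed.

Lemma quintic_branch_eq (A : comNzRingType) (x : A) (I : finType) (w : I -> A) :
  quintic x = \prod_i ('X - (w i)%:P) -> forall i, w i ^+ 5 + w i + x = 0.
Proof.
move=> Dx i; rewrite -horner_quintic Dx horner_prod (bigD1 i) //=.
by rewrite hornerXsubC subrr mul0r.
Qed.

Lemma quintic_root_branch (A : idomainType) (x : A) (I : finType) (w : I -> A) (y : A) :
  quintic x = \prod_i ('X - (w i)%:P) -> root (quintic x) y -> exists i, y = w i.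
Proof.
move=> ->; rewrite rootE horner_prod => /prodf_eq0[i _].
by rewrite hornerXsubC subr_eq0 => /eqP; exists i.
Qed.

Lemma quintic_double (A : idomainType) (x : A) (I : finType) (w : I -> A) i j :
  quintic x = \prod_i ('X - (w i)%:P) -> i != j -> w i = w j ->
  5%:R * w i ^+ 4 + 1 = 0.
Proof.
move=> Dx nij eij; rewrite -(deriv_quintic x) Dx deriv_prod_XsubC.
by rewrite (bigD1 j) /= 1?eq_sym // -eij subrr mul0r.
Qed.

Lemma fps_algebraic_constant (f : fps K) (p : {poly K}) : p != 0 ->
  root (map_poly (@fpsC K) p) f -> exists c, f = fpsC c.
Proof. exact: root_of_closed_constant. Qed.

Lemma puiseux_quintic (x0 : K) : exists N (w : 'I_5 -> fps K), (0 < N)%N /\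
  quintic (fpsC x0 + fpsX ^+ N) = \prod_i ('X - (w i)%:P).
Proof.
have [N N0 [rs Drs]] := puiseux (quintic_monic (fpsC x0 + fpsX)).
rewrite map_quintic rmorphD /= ramifyC ramifyX // in Drs.
have srs : size rs = 5%N.
  have := size_quintic (fpsC x0 + fpsX ^+ N : fps K).
  by rewrite Drs size_prod_XsubC => -[].
exists N, (fun i => rs`_i); split=> //; rewrite Drs -srs.
by rewrite (big_nth 0) big_mkord.
Qed.

(** [rho] is a double root of X^5 + X + x0, and [w] lists the roots of the
    quintic as series in an N-th root of x - x0. *)
Section Local.
Variables (rho : K) (N : nat) (w : 'I_5 -> fps K).
Hypothesis rhoE : 5%:R * rho ^+ 4 + 1 = 0.
Hypothesis N0 : (0 < N)%N.
Let x0 := - (rho ^+ 5 + rho).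
Let x := fpsC x0 + fpsX ^+ N.
Hypothesis wE : quintic x = \prod_i ('X - (w i)%:P).

Lemma branch_param_nonconst c : x <> fpsC c.
Proof.
move/(congr1 (fun f : fps K => f N)); rewrite fps_coefD fpsXn eqxx /= gtn_eqF //.
by rewrite add0r => /eqP; rewrite oner_eq0.
Qed.

Lemma branch_nonconst i c : w i <> fpsC c.
Proof.
move=> Dw; apply: (@branch_param_nonconst (- (c ^+ 5 + c))).
apply/eqP; rewrite rmorphN rmorphD rmorphXn /= -Dw -addr_eq0.
by rewrite addrC (quintic_branch_eq wE).
Qed.

Lemma branch_simple i : 5%:R * w i ^+ 4 + 1 <> 0.
Proof.
move=> D; have [||c] := @fps_algebraic_constant (w i) (5%:R *: 'X^4 + 1%:P).
- rewrite -size_poly_gt0 size_polyDl ?size_scale ?size_polyXn ?pnatr_eq0 //.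
  by rewrite size_polyC oner_eq0.
- rewrite rmorphD /= map_polyZ map_polyXn map_polyC /= rmorph_nat !rmorph1.
  by rewrite rootE hornerD hornerZ hornerXn hornerC D.
exact: branch_nonconst.
Qed.

Lemma branch_inj : injective w.
Proof.
move=> i j eij; apply: contrapT => /eqP nij.
exact: (branch_simple (quintic_double wE nij eij)).
Qed.

Let c i := w i 0%N.
Lemma branch_param0 : x 0%N = x0.
Proof. by rewrite fps_coefD fpsXn /= eq_sym gtn_eqF // addr0. Qed.

Lemma branch_const_prod : quintic x0 = \prod_i ('X - (c i)%:P).
Proof.
have <- : map_poly (@fps_const K) (quintic x) = quintic x0.
  by rewrite map_quintic; congr quintic; exact: branch_param0.
rewrite wE rmorph_prod; apply: eq_bigr => i _.
by rewrite /= map_polyXsubC.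
Qed.

(** At a double root y, both 5 y^4 + 1 and y^5 + y + x0 vanish, and together they
    determine y linearly: y = -5 x0 / 4. *)
Lemma double_root_unique y : 5%:R * y ^+ 4 + 1 = 0 -> root (quintic x0) y -> y = rho.
Proof.
move=> Dy; rewrite rootE horner_quintic /x0 => /eqP E.
have E1 : 5%:R * (y ^+ 5 + y - (rho ^+ 5 + rho)) = y * (5%:R * y ^+ 4 + 1)
   - rho * (5%:R * rho ^+ 4 + 1) + 4%:R * (y - rho) by ring.
move: E1; rewrite E Dy rhoE !mulr0 subr0 add0r => /esym/eqP.
by rewrite mulf_eq0 pnatr_eq0 subr_eq0 => /eqP.
Qed.

Lemma branch_const_coincide i j : i != j -> c i = c j -> c i = rho.
Proof.
move=> nij eij; apply: double_root_unique.
  exact: quintic_double branch_const_prod nij eij.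
by rewrite rootE branch_const_prod horner_prod (bigD1 i) //= hornerXsubC subrr mul0r.
Qed.

(** Exactly two of the five branches meet at [rho], because the second derivative
    of the quintic does not vanish there. *)
Lemma double_root_pair : exists i j, [/\ i != j, c i = rho, c j = rho
  & forall k, k != i -> k != j -> c k != rho].
Proof.
have r0 : root (quintic x0) rho by rewrite rootE horner_quintic /x0 subrr.
have [i Di] := quintic_root_branch branch_const_prod r0.
have [j nji Dj] : exists2 j, j != i & c j = rho.
  have := deriv_quintic x0 rho.
  rewrite rhoE branch_const_prod Di deriv_prod_XsubC => /eqP.
  by case/prodf_eq0=> j nji; rewrite subr_eq0 => /eqP Dj; exists j; rewrite ?Di.
exists i, j; split=> //; first by rewrite eq_sym.
move=> k nki nkj; apply/eqP => Dk.
have nzr : rho != 0.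
  by apply: contra_eq_neq rhoE => ->; rewrite expr0n mulr0 add0r oner_neq0.
(* a third branch through rho would make the second derivative vanish *)
have D2 : (quintic x0)^`()^`().[rho] = 20%:R * rho ^+ 3.
  have -> : (quintic x0)^`() = 'X^4 *+ 5 + 1%:P.
    by rewrite /quintic !derivD derivXn derivX derivC addr0.
  rewrite derivD derivMn derivXn derivC addr0 !hornerMn hornerXn.
  by rewrite -mulrnA mulr_natl.
move: D2; rewrite branch_const_prod (bigD1 i) //= (bigD1 j) //= (bigD1 k) /= ?nki //.
rewrite -Di Dj Dk; set h := \prod_(_ | _) _ => D2.
have nz20 : 20%:R != 0 :> K by rewrite pnatr_eq0.
have /eqP := mulf_neq0 nz20 (expf_neq0 3 nzr); apply.
rewrite -D2 !derivM !derivD !derivM !derivXsubC.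
by rewrite !(hornerXsubC, hornerM, hornerD) !subrr; ring.
Qed.
End Local.
End QuinticOverPoint.

(** * Monodromy around the branch point *)

Section Monodromy.
Variable K : numClosedFieldType.

Lemma closed_prim_root N : (0 < N)%N -> exists z : K, N.-primitive_root z.
Proof.
move=> N0; have [rs] := closed_field_poly_normal ('X^N - 1%:P : {poly K}).
rewrite (monicP (monicXnsubC _ N0)) scale1r => Drs.
have srs : size rs = N.
  have := congr1 (fun r : {poly K} => size r) Drs.
  by rewrite /= size_XnsubC // size_prod_XsubC => -[].
have: has N.-primitive_root rs.
  apply: has_prim_root => //; rewrite ?srs //.
    apply/allP => z; rewrite -root_prod_XsubC -Drs.
    by rewrite /root !hornerE subr_eq0 unity_rootE.
  rewrite -separable_prod_XsubC -Drs polyC1.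
  by rewrite separable_Xn_sub_1 // pnatr_eq0 -lt0n.
by case/hasP=> z _ zP; exists z.
Qed.

(** One turn of the N-th root of x - x0 around the branch point, when [z] is a
    primitive N-th root of unity. *)
Definition rotate (z : K) : fps K -> fps K := fps_comp (fpsC z * fpsX).
HB.instance Definition _ z := GRing.RMorphism.on (rotate z).

Lemma rotateE z f n : rotate z f n = z ^+ n * f n.
Proof.
have v0 : (fpsC z * fpsX) 0%N = 0 by rewrite fpsCM mulr0.
rewrite /rotate fps_compE // big_ord_recr /= exprMn -rmorphXn fpsCM fpsXn eqxx.
rewrite mulr1 [f n * _]mulrC big1 ?add0r // => k _.
by rewrite exprMn -rmorphXn fpsCM fpsXn gtn_eqF ?mulr0.
Qed.

Lemma rotateC z c : rotate z (fpsC c) = fpsC c.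
Proof. exact: fps_compC. Qed.

Variables (rho : K) (N : nat) (w : 'I_5 -> fps K).
Hypothesis rhoE : 5%:R * rho ^+ 4 + 1 = 0.
Hypothesis N0 : (0 < N)%N.
Let x0 := - (rho ^+ 5 + rho).
Let x := fpsC x0 + fpsX ^+ N.
Hypothesis wE : quintic x = \prod_i ('X - (w i)%:P).

(** A series that is fixed by the rotation is a series in x - x0 itself; then the
    quintic at w = rho + d reads x - x0 = d^2 (...), whereas d is divisible by
    x - x0. *)
Lemma rotate_moves z i : N.-primitive_root z -> w i 0%N = rho ->
  rotate z (w i) != w i.
Proof.
move=> prz wi0; apply/eqP => fixw.
have [|h [Dh _]] := @fps_divXn _ N (w i - fpsC rho).
  case=> [|n] ltn; first by rewrite fps_coefB wi0 subrr.
  rewrite fps_coefB subr0; have := congr1 (fun f : fps K => f n.+1) fixw.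
  rewrite rotateE => /eqP; rewrite -subr_eq0 -[X in _ - X]mul1r -mulrBl mulf_eq0.
  case/orP=> [|/eqP//]; rewrite subr_eq0 -(prim_order_dvd prz).
  by move/(dvdn_leq (ltn0Sn n)); rewrite leqNgt ltn.
have Dw : w i = fpsC rho + fpsX ^+ N * h by rewrite -Dh addrC subrK.
pose r := fpsC rho; pose d := fpsX ^+ N * h.
have r1 : 5%:R * r ^+ 4 + 1 = 0.
  by rewrite -(rmorph0 (@fpsC K)) -rhoE rmorphD rmorphM rmorphXn /= rmorph_nat rmorph1.
have r2 : fpsC x0 = - (r ^+ 5 + r) by rewrite rmorphN rmorphD rmorphXn.
have := quintic_branch_eq wE i; rewrite /x r2 Dw -/r -/d => E.
(* Taylor expansion at r, with a vanishing term of order one *)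
have E2 : (r + d) ^+ 5 + (r + d) + (- (r ^+ 5 + r) + fpsX ^+ N) =
    d * (5%:R * r ^+ 4 + 1) + fpsX ^+ N +
    d ^+ 2 * (10%:R * r ^+ 3 + 10%:R * r ^+ 2 * d + 5%:R * r * d ^+ 2 + d ^+ 3) by ring.
move: E; rewrite E2 r1 mulr0 add0r; set q := (X in d ^+ 2 * X).
move/(congr1 (fun f : fps K => f N)) => /eqP.
rewrite fps_coefD fpsXn eqxx /d exprMn -exprM -mulrA fpsXnM leqNgt.
by rewrite -[X in (X < _)%N]muln1 ltn_pmul2l // addr0 oner_eq0.
Qed.

(** The rotation permutes the branches and preserves constant terms, hence fixes
    the three branches that are alone over their constant term; the two others
    are not fixed, so they are exchanged. *)
Lemma monodromy_transposition : exists sigma : {rmorphism fps K -> fps K},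
  (forall c, sigma (fpsC c) = fpsC c) /\
  exists i j, i != j /\ forall k, sigma (w k) = w (tperm i j k).
Proof.
have [z prz] := closed_prim_root N0.
exists (rotate z); split; first exact: rotateC.
have sx : rotate z x = x.
  rewrite rmorphD rmorphXn /= rotateC; congr (_ + _).
  rewrite /rotate fps_compX ?fpsCM ?mulr0 // exprMn -rmorphXn (prim_expr_order prz).
  by rewrite rmorph1 mul1r.
have /choice[f fP] k : exists j, rotate z (w k) = w j.
  have /quintic_root_branch : root (quintic x) (rotate z (w k)).
    rewrite -sx -map_quintic; apply: rmorph_root.
    by rewrite rootE horner_quintic (quintic_branch_eq wE).
  by move/(_ _ _ wE).
have f0 k : w (f k) 0%N = w k 0%N by rewrite -fP rotateE mul1r.
have fne k : w k 0%N = rho -> f k != k.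
  move=> wk; apply: contraTneq (rotate_moves prz wk) => fk.
  by rewrite negbK -[X in _ == w X]fk; apply/eqP; exact: fP.
have [i [j [nij ci cj other]]] := double_root_pair rhoE N0 wE.
exists i, j; split=> // k; transitivity (w (f k)); [exact: fP | congr (w _)].
have two l : w l 0%N = rho -> l = i \/ l = j.
  move=> cl; have [|ni] := eqVneq l i; first by left.
  have [|nj] := eqVneq l j; first by right.
  by have := other l ni nj; rewrite /= cl eqxx.
case: tpermP => [->|->|/eqP nki /eqP nkj].
- have [||//] := two (f i); first by rewrite f0.
  by move/eqP; rewrite (negPf (fne _ ci)).
- have [||] := two (f j) => //; first by rewrite f0.
  by move/eqP; rewrite (negPf (fne _ cj)).
- apply: contrapT => /eqP nfk; have := other k nki nkj; rewrite eq_sym in nfk.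
  by rewrite (branch_const_coincide rhoE N0 wE nfk) ?eqxx //= f0.
Qed.
End Monodromy.

(** * The Galois group of the quintic *)

(** The relation [tperm i j \in G] is an equivalence whose classes are permuted
    transitively by [G], so they all have the same size; this size divides the
    prime #|T| and is not 1. *)
Lemma transitive_tperm_full (T : finType) (G : {group {perm T}}) (a b : T) :
    prime #|T| -> a != b -> tperm a b \in G ->
    (forall i j, exists2 s, s \in G & s i = j) ->
  forall s, s \in G.
Proof.
move=> prT nab Gab trG.
pose e i j := tperm i j \in G.
have eJ s i j : s \in G -> e (s i) (s j) = e i j.
  by move=> Gs; rewrite /e -tpermJ memJ_norm // (fintype.subsetP (normG G)).
have eqv : {in [set: T] & &, equivalence_rel e}.
  move=> i j k _ _ _; split; first by rewrite /e tperm1 group1.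
  have tr i' j' k' : e i' j' -> e j' k' -> e i' k'.
    move=> eij ejk; have [->|nik] := eqVneq i' k'; first by rewrite /e tperm1 group1.
    have [-> //|nij] := eqVneq i' j'.
    by rewrite -(eJ (tperm j' k')) // tpermL tpermD in eij; rewrite // eq_sym.
  by move=> eij; apply/idP/idP; apply: tr => //; rewrite /e tpermC.
have part := equivalence_partitionP eqv.
pose c := #|[set j | e a j]|.
have cE i : #|[set j | e i j]| = c.
  have [s Gs <-] := trG a i; rewrite /c -[RHS](card_imset _ (@perm_inj _ s)).
  apply: eq_card => j; rewrite [LHS]inE; apply/idP/imsetP => [ej|[k]].
    by exists ((s^-1)%g j); rewrite ?permKV // inE -(eJ s) // permKV.
  by rewrite inE => ek ->; rewrite eJ.
have cP : {in equivalence_partition e [set: T], forall A : {set T}, #|A| = c}.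
  by move=> A /imsetP[i _ ->]; rewrite -(cE i); apply: eq_card => j; rewrite !inE.
have := card_uniform_partition cP part; rewrite cardsT => cardT.
have c2 : (1 < c)%N.
  rewrite /c (cardsD1 a) inE /e tperm1 group1 add1n ltnS card_gt0.
  by apply/finset.set0Pn; exists b; rewrite !inE eq_sym nab.
have cT : c = #|T|.
  have /(prime_nt_dvdP prT) : (c %| #|T|)%N by rewrite cardT dvdn_mull.
  by apply; rewrite neq_ltn c2 orbT.
have all_e i j : e i j.
  have : [set j | e i j] == [set: T] by rewrite eqEcard finset.subsetT cE cT cardsT /=.
  by move/eqP/setP/(_ j); rewrite !inE.
move=> s; have [ts -> _] := prod_tpermP s.
by apply: group_prod => t _; apply: all_e.
Qed.

Lemma exists_nonroot (R : idomainType) (p : {poly R}) (s : nat -> R) :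
  injective s -> p != 0 -> exists n, p.[s n] != 0.
Proof.
move=> injs nzp; apply: contrapT => nroot.
pose rs := [seq s n | n <- iota 0 (size p)].
have: (size rs < size p)%N.
  apply: max_poly_roots => //; last by rewrite map_inj_uniq ?iota_uniq.
  apply/allP => _ /mapP[n _ ->]; apply: contrapT => /negP nz.
  by apply: nroot; exists n.
by rewrite size_map size_iota ltnn.
Qed.

Section Relations.
Variables (K : numClosedFieldType) (x : fps K) (w : 'I_5 -> fps K).
Hypothesis wE : quintic x = \prod_i ('X - (w i)%:P).
Hypothesis branch_simple : forall i, 5%:R * w i ^+ 4 + 1 <> 0.
Hypothesis branch_nonconst : forall i c, w i <> fpsC c.

Definition env5 (D : Type) (u : 'I_5 -> D) : nat -> D := fun n => u (inord n).
Definition ev5 (D : comNzRingType) (e0 : {rmorphism K -> D}) (u : 'I_5 -> D) :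
  {rmorphism ip K 5 -> D} := ev e0 (env5 u) 5.

Definition rename (s : 'I_5 -> 'I_5) : {rmorphism ip K 5 -> ip K 5} :=
  ev5 (ip_const K 5) (fun j => ip_var K 5 (s j)).

Lemma ev5_var (D : comNzRingType) (e0 : {rmorphism K -> D}) u (j : 'I_5) :
  ev5 e0 u (ip_var K 5 j) = u j.
Proof. by rewrite /ev5 ev_var // /env5 inord_val. Qed.

Lemma ev5_eq (D : comNzRingType) (e0 : {rmorphism K -> D}) u u' Q :
  u =1 u' -> ev5 e0 u Q = ev5 e0 u' Q.
Proof. by move=> euu; apply: ev_eq => j _; apply: euu. Qed.

Lemma ev5_rename (D : comNzRingType) (e0 : {rmorphism K -> D}) u s Q :
  ev5 e0 u (rename s Q) = ev5 e0 (u \o s) Q.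
Proof.
rewrite /rename {2}/ev5 (@ev_map _ _ _ _ e0) => [|c]; last exact: ev_const.
by apply: ev_eq => j _; exact: ev5_var.
Qed.

Local Notation evw := (ev5 (@fpsC K) w).

(** As in Galois' own definition, the group of the equation consists of the
    permutations of the roots that preserve every polynomial relation between
    them. *)
Definition preserves (s : 'I_5 -> 'I_5) :=
  forall Q, evw Q = 0 -> ev5 (@fpsC K) (w \o s) Q = 0.

Lemma quintic_param_of_branch i : - (w i ^+ 5 + w i) = x.
Proof. by apply/eqP; rewrite eq_sym -addr_eq0 addrC (quintic_branch_eq wE). Qed.

(** The coefficients of the product of all X - X_j minus the quintic are relations
    between the roots, so that [w \o s] lists the roots of the quintic too; these
    are simple. *)
Lemma preserves_inj s : preserves s -> injective s.
Proof.
move=> ps; pose x0 := ip_var K 5 (@ord0 4).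
pose G : {poly ip K 5} :=
  \prod_(j < 5) ('X - (ip_var K 5 j)%:P) - quintic (- (x0 ^+ 5 + x0)).
have mapG u : map_poly (ev5 (@fpsC K) u) G =
    \prod_j ('X - (u j)%:P) - quintic (- (u ord0 ^+ 5 + u ord0)).
  rewrite rmorphB rmorph_prod; congr (_ - _).
    by apply: eq_bigr => j _; rewrite [LHS]map_polyXsubC ev5_var.
  by rewrite [LHS]map_quintic rmorphN rmorphD rmorphXn ev5_var.
have sE : quintic x = \prod_j ('X - (w (s j))%:P).
  apply/eqP; rewrite eq_sym -subr_eq0 -[x](quintic_param_of_branch (s ord0)).
  rewrite -(mapG (w \o s)); apply/eqP/polyP => j; rewrite coef_map coef0.
  apply: ps; transitivity ((map_poly evw G)`_j); first by rewrite coef_map.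
  by rewrite mapG quintic_param_of_branch -wE subrr coef0.
move=> j k ejk; apply: contrapT => /eqP njk.
apply: (branch_simple (i := s j)).
apply: (@quintic_double _ x _ (w \o s) j k) => //.
by rewrite /comp ejk.
Qed.

Lemma nat_fps_inj : injective (fun n : nat => n%:R : fps K).
Proof.
move=> m n /(congr1 (@fps_const K)); rewrite !rmorph_nat.
by move/eqP; rewrite eqr_nat => /eqP.
Qed.

(** Finitely many relations are combined into a single one by taking a general
    linear combination. *)
Lemma common_relation (I : finType) (P : pred I)
    (u : I -> {rmorphism ip K 5 -> fps K}) :
    (forall i, P i -> exists2 Q, evw Q = 0 & u i Q != 0) ->
  exists2 T, evw T = 0 & forall i, P i -> u i T != 0.
Proof.
move=> bad.
have /choice[Q QP] i : exists Q, evw Q = 0 /\ (P i -> u i Q != 0).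
  have [/bad[Q Q0 Q1]|_] := boolP (P i); first by exists Q.
  by exists 0; rewrite rmorph0.
pose p i : {poly fps K} := \sum_j u i (Q j) *: 'X^(enum_rank j).
have nzp i : P i -> p i != 0.
  move=> Pi; apply: contraTneq ((QP i).2 Pi) => p0; rewrite negbK.
  have := coef0 (fps K) (enum_rank i); rewrite -p0 coef_sum (bigD1 i) //=.
  rewrite coefZ coefXn eqxx mulr1 big1 ?addr0 => [->//|j nji].
  by rewrite coefZ coefXn val_eqE (inj_eq enum_rank_inj) eq_sym (negPf nji) mulr0.
have nzP : \prod_(i | P i) p i != 0 by apply/prodf_neq0 => i; apply: nzp.
have [n nzn] := exists_nonroot nat_fps_inj nzP.
exists (\sum_j Q j * n%:R ^+ enum_rank j).
  by rewrite rmorph_sum big1 // => j _; rewrite rmorphM (QP j).1 mul0r.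
move=> i Pi; move: nzn; rewrite horner_prod => /prodf_neq0/(_ i Pi).
suff -> : u i (\sum_j Q j * n%:R ^+ enum_rank j) = (p i).[n%:R] by [].
rewrite rmorph_sum horner_sum; apply: eq_bigr => j _.
by rewrite hornerZ hornerXn rmorphM rmorphXn rmorph_nat.
Qed.

(** Every root is a root of the quintic with parameter x = - (X_0^5 + X_0).  The
    relations between distinct roots are not imposed here; [preserves_inj] takes
    care of repetitions. *)
Definition nth_relation n : {poly ip K n.+1} :=
  quintic (- (ip_var K n.+1 0 ^+ 5 + ip_var K n.+1 0)).

Lemma map_nth_relation (env : nat -> fps K) n :
  map_poly (ev (@fpsC K) env n.+1) (nth_relation n) =
    quintic (- (env 0%N ^+ 5 + env 0%N)).
Proof. by rewrite map_quintic rmorphN rmorphD rmorphXn ev_var. Qed.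

(** Eliminating all roots but the first from [T] gives a polynomial over K in one
    variable that vanishes at [w 0], which is transcendental over K.  So it is the
    zero polynomial and vanishes at [w i] too, and solving back gives the other
    roots. *)
Lemma conjugate_arrangement i (T : ip K 5) : evw T = 0 ->
  exists s : {ffun 'I_5 -> 'I_5}, s ord0 = i /\ ev5 (@fpsC K) (w \o s) T = 0.
Proof.
move=> T0; pose N := @eliminate K 0 nth_relation 4 T.
have mR n : nth_relation n \is monic by exact: quintic_monic.
have N0 : ev (@fpsC K) (env5 w) 1 N = 0.
  apply: (@eliminate_root K 0 nth_relation mR) => [j ltj|]; last exact: T0.
  rewrite map_nth_relation quintic_param_of_branch rootE horner_quintic.
  by rewrite (quintic_branch_eq wE).
have Nz : N = 0.
  apply: contrapT => /eqP nzN.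
  have [||c] := @fps_algebraic_constant _ (w (inord 0)) (N : {poly K}) => //.
    by apply/eqP; exact: N0.
  exact: branch_nonconst.
pose S k (Q : ip K (k + 0).+1) := exists s : nat -> 'I_5, s 0%N = i /\
  ev (@fpsC K) (w \o s) (k + 0).+1 Q = 0.
have [s [s0 sT]] : S 4%N T; last first.
  exists [ffun j : 'I_5 => s j]; rewrite ffunE; split=> //.
  rewrite -[RHS]sT; apply: ev_eq => j ltj; rewrite /env5 /= ffunE.
  by rewrite inordK.
apply: (@eliminate_ind K 0 nth_relation S); last first.
  by exists (fun=> i); split=> //; rewrite -/N Nz rmorph0.
move=> k Q [s [s0 sQ]].
pose n := (k + 0)%N.
have Rs : map_poly (ev (@fpsC K) (w \o s) n.+1) (nth_relation n) =
    \prod_(r <- [seq w j | j : 'I_5]) ('X - r%:P).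
  by rewrite map_nth_relation /= quintic_param_of_branch wE big_image.
have [_ /mapP[j _ ->] rQ] := norm_resultant_splits (mR n) Rs sQ.
exists (fun m => if m == n.+1 then j else s m); split=> //.
transitivity ((map_poly (ev (@fpsC K) (w \o s) n.+1) Q).[w j]); last exact/eqP.
rewrite [LHS]evS; congr (_.[_]); last by rewrite /= eqxx.
by apply: eq_map_poly => q; apply: ev_eq => m ltm; rewrite /= ltn_eqF.
Qed.

Definition relation_group : {set 'S_5} := [set s : 'S_5 | `[< preserves s >]].

Lemma relation_groupP (s : 'S_5) : reflect (preserves s) (s \in relation_group).
Proof. by rewrite inE; exact: asboolP. Qed.

Fact relation_group_set : group_set relation_group.
Proof.
apply/group_setP; split.
  apply/relation_groupP => Q <-; apply: ev5_eq => j.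
  by rewrite /= perm1.
move=> s t /relation_groupP ps /relation_groupP pt; apply/relation_groupP => Q Q0.
transitivity (ev5 (@fpsC K) ((w \o t) \o s) Q).
  by apply: ev5_eq => j; rewrite /= permM.
by rewrite -ev5_rename; apply: pt; rewrite ev5_rename; apply: ps.
Qed.
Canonical relation_group_group := Group relation_group_set.

(** If each arrangement of the roots that begins with [w i] violated some relation,
    a common relation would be violated by all of them, contrary to
    [conjugate_arrangement]. *)
Lemma relation_group_orbit i : exists2 s, s \in relation_group & s ord0 = i.
Proof.
suff [s [s0 ps]] : exists s : {ffun 'I_5 -> 'I_5}, s ord0 = i /\ preserves s.
  exists (perm (preserves_inj ps)); last by rewrite permE.
  apply/relation_groupP => Q /ps <-; apply: ev5_eq => j.
  by rewrite /= permE.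
apply: contrapT => nos.
have [|T T0 Tn] := @common_relation {ffun 'I_5 -> 'I_5} (fun s => s ord0 == i)
    (fun s => ev5 (@fpsC K) (w \o s)).
- move=> s /eqP s0; apply: contrapT => noQ; apply: nos; exists s; split=> // Q Q0.
  by apply: contrapT => /eqP nz; apply: noQ; exists Q.
have [s [/eqP s0 sT]] := conjugate_arrangement i T0.
by have := Tn s s0; rewrite sT eqxx.
Qed.

Lemma relation_group_full (sigma : {rmorphism fps K -> fps K}) a b :
    (forall c, sigma (fpsC c) = fpsC c) -> a != b ->
    (forall k, sigma (w k) = w (tperm a b k)) ->
  forall s : 'S_5, preserves s.
Proof.
move=> sC nab sw s; apply/relation_groupP.
apply: (@transitive_tperm_full _ relation_group_group a b) => //.
- by rewrite card_ord.
- apply/relation_groupP => Q Q0.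
  have := ev_map (env5 w) (n := 5) Q sC; rewrite [ev _ _ _ _]Q0 rmorph0 => ->.
  by apply: ev_eq => j _; rewrite /env5 /= sw.
move=> i j; have [s1 G1 D1] := relation_group_orbit i.
have [s2 G2 D2] := relation_group_orbit j.
exists (s1^-1 * s2)%g; first by rewrite groupM // groupV.
by rewrite permM -D1 permK.
Qed.
End Relations.

(** * The splitting field of the generic quintic *)

Lemma Alt_perfect (T : finType) : (4 < #|T|)%N -> ([~: 'Alt_T, 'Alt_T] = 'Alt_T)%g.
Proof.
move=> T5; have /simpleP[nt1 simp] := simple_Alt5 T5.
have [der1|//] := simp _ (der_normal 1 'Alt_T); case/idP: (solvable_AltF T5).
by rewrite abelian_sol //; apply/derG1P.
Qed.

Lemma subg_perfect (gT : finGroupType) (G : {group gT}) :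
  ([~: G, G] = G)%g ->
  ([~: [set: subg_of G], [set: subg_of G]] = [set: subg_of G])%g.
Proof.
move=> perfG; apply/eqP; rewrite finset.eqEsubset finset.subsetT /=.
rewrite -(injmSK (injm_sgval G)) ?finset.subsetT //.
by rewrite morphimR ?finset.subsetT // im_sgval perfG.
Qed.

Lemma even_perm_moves (i : 'I_5) : exists2 s : 'S_5, s \in ('Alt_('I_5))%g & s i != i.
Proof.
have [j [k /and3P[nji nki njk]]] : exists j k : 'I_5, [&& j != i, k != i & j != k].
  case: i => [[|[|[|[|[|//]]]]] lti];
    [exists (inord 1), (inord 2) | exists (inord 0), (inord 2)
    |exists (inord 0), (inord 1) | exists (inord 0), (inord 1)
    |exists (inord 0), (inord 1)]; by rewrite -!val_eqE /= !inordK.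
exists (tperm i j * tperm i k)%g.
  by rewrite Alt_even odd_permM !odd_tperm eq_sym nji eq_sym nki.
by rewrite permM tpermL tpermD // eq_sym.
Qed.

Section QuinticField.
Variable K : numClosedFieldType.

Lemma exists_rho : exists rho : K, 5%:R * rho ^+ 4 + 1 = 0.
Proof.
have : size (5%:R *: 'X^4 + 1%:P : {poly K}) != 1%N.
  rewrite size_polyDl ?size_scale ?size_polyXn ?pnatr_eq0 //.
  by rewrite size_polyC oner_eq0.
case/closed_rootP => rho; rewrite rootE hornerD hornerZ hornerXn hornerC => /eqP.
by exists rho.
Qed.

(** The splitting field is the field of fractions of K[w_1, ..., w_5].  Renaming
    the variables by a permutation preserves relations, so it acts on this field;
    the action is restricted to the alternating group, which is perfect. *)
Lemma quintic_gfield :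
  exists (gT : finGroupType) (L : gfield K gT) (x : L) (w : 'I_5 -> L),
  ([~: [set: gT], [set: gT]] = [set: gT])%g /\
  [/\ forall g, gf_act g x = x, x != 0, quintic x = \prod_i ('X - (w i)%:P)
    & forall i, exists g, gf_act g (w i) != w i].
Proof.
have [rho rhoE] := exists_rho.
have [N [w [N0 wE]]] := puiseux_quintic (- (rho ^+ 5 + rho)).
set x := _ + _ in wE.
have [sigma [sC [a [b [nab sw]]]]] := monodromy_transposition rhoE N0 wE.
have full := relation_group_full wE (branch_simple N0 wE)
  (branch_nonconst N0 wE) sC nab sw.
pose phi := ev5 (@fpsC K) w.
have [L [pi [gen ker]]] := image_field phi.
have ker_rename (s : 'S_5) Q : (pi Q == 0) = (pi (rename K s Q) == 0).
  rewrite !ker /phi ev5_rename; apply/eqP/eqP => [/(full s)//|Q0].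
  rewrite -(full (s^-1)%g (rename K s Q)).
    by rewrite ev5_rename; apply: ev5_eq => j; rewrite /= permK.
  by rewrite ev5_rename.
have /choice[act actP] s : exists f : {rmorphism L -> L}, forall Q,
    f (pi Q) = pi (rename K (sgval (s : subg_of ('Alt_('I_5))%G)) Q).
  exact: (rmorph_frac gen (chi := pi \o rename K (sgval s)) (ker_rename _)).
have act_ext (f g : {rmorphism L -> L}) :
    (forall Q, f (pi Q) = g (pi Q)) -> f =1 g.
  by move=> efg y; have [[c d] /= [_ ->]] := gen y; rewrite !fmorph_div !efg.
have pi_eq Q Q' : phi Q = phi Q' -> pi Q = pi Q'.
  by move=> eQ; apply/eqP; rewrite -subr_eq0 -rmorphB ker rmorphB eQ subrr.
have act1 y : act 1%g y = y.
  move: y; apply: (act_ext _ idfun) => Q; rewrite actP; apply: pi_eq.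
  by rewrite /phi ev5_rename; apply: ev5_eq => j; rewrite /= perm1.
have actM s t y : act (s * t)%g y = act t (act s y).
  move: y; apply: (act_ext _ (act t \o act s)) => Q.
  rewrite [RHS]/= !actP; apply: pi_eq; rewrite /phi !ev5_rename.
  by apply: ev5_eq => j; rewrite /= permM.
pose emb : {rmorphism K -> L} := pi \o ip_const K 5.
have act_emb s c : act s (emb c) = emb c.
  rewrite /emb [LHS]actP; apply: pi_eq; rewrite /phi ev5_rename.
  by rewrite /ev5 !ev_const.
pose v j := pi (ip_var K 5 (j : 'I_5)).
have act_v s j : act s (v j) = v (sgval s j).
  rewrite /v actP; apply: pi_eq; rewrite /phi ev5_rename.
  by rewrite !ev5_var.
pose y := - (v ord0 ^+ 5 + v ord0).
pose G : {poly ip K 5} := \prod_(j < 5) ('X - (ip_var K 5 j)%:P) -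
  quintic (- (ip_var K 5 (@ord0 4) ^+ 5 + ip_var K 5 (@ord0 4))).
have mapG (D : comNzRingType) (u : {rmorphism ip K 5 -> D}) : map_poly u G =
    \prod_j ('X - (u (ip_var K 5 (j : 'I_5)))%:P) -
    quintic (- (u (ip_var K 5 (@ord0 4)) ^+ 5 + u (ip_var K 5 (@ord0 4)))).
  rewrite rmorphB rmorph_prod; congr (_ - _).
    by apply: eq_bigr => j _; rewrite [LHS]map_polyXsubC.
  by rewrite [LHS]map_quintic rmorphN rmorphD rmorphXn.
have phiG : map_poly phi G = 0.
  rewrite mapG /phi !ev5_var (quintic_param_of_branch wE) wE.
  apply/eqP; rewrite subr_eq0; apply/eqP.
  by apply: eq_bigr => j _; rewrite ev5_var.
have vE : quintic y = \prod_j ('X - (v j)%:P).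
  apply/eqP; rewrite eq_sym -subr_eq0 -(mapG L pi); apply/eqP/polyP => j.
  rewrite coef_map coef0; apply/eqP; rewrite ker; apply/eqP.
  by transitivity ((map_poly phi G)`_j); [rewrite coef_map | rewrite phiG coef0].
exists (subg_of ('Alt_('I_5))%G : finGroupType), (GField act1 actM act_emb), y, v.
split; first by apply: subg_perfect; apply: Alt_perfect; rewrite card_ord.
split=> [s|||i] //.
- rewrite /= rmorphN rmorphD rmorphXn /= act_v; apply/eqP.
  rewrite eqr_oppLR -addr_eq0; apply/eqP.
  exact: (quintic_branch_eq vE).
- rewrite oppr_eq0 -rmorphXn -rmorphD ker rmorphD rmorphXn /phi !ev5_var.
  rewrite -oppr_eq0 (quintic_param_of_branch wE); apply/eqP => x0.
  by apply: (branch_param_nonconst (rho := rho) N0 (c := 0)); rewrite rmorph0.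
- have [s sA si] := even_perm_moves i; exists (subg _ s); rewrite /= act_v subgK //.
  apply: contraNneq si => /eqP; rewrite -subr_eq0 -rmorphB ker rmorphB /phi !ev5_var.
  by rewrite subr_eq0 => /eqP/(branch_inj N0 wE)->.
Qed.
End QuinticField.

(** * Solving polynomial equations in tame series *)

Section LocalSplitting.
Variables (K : numClosedFieldType) (gT : finGroupType).
Hypothesis perfect : ([~: [set: gT], [set: gT]] = [set: gT])%g.
Implicit Types L : gfield K gT.

Definition fps_fixed L (f : fps L) := forall g : gT, fps_map (gf_act g) f = f.

(** Fixed coefficients encode solvability; the constant term in K is what
    integrality over K[a, b] gives at the origin, and it allows to expand an
    algebraic function at that constant. *)
Definition tame L : {pred fps L} :=
  fun f => `[< fps_fixed f /\ exists c, f 0%N = gf_emb L c >].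
Lemma tameP L (f : fps L) :
  reflect (fps_fixed f /\ exists c, f 0%N = gf_emb L c) (f \in @tame L).
Proof. exact: asboolP. Qed.

Fact tame_subring L : subring_closed (@tame L).
Proof.
split.
- by apply/tameP; split=> [g|]; [rewrite rmorph1 | exists 1; rewrite rmorph1].
- move=> f g /tameP[ff [c fc]] /tameP[fg [d gd]]; apply/tameP; split.
    by move=> s; rewrite rmorphB /= ff fg.
  by exists (c - d); rewrite fps_coefB fc gd rmorphB.
- move=> f g /tameP[ff [c fc]] /tameP[fg [d gd]]; apply/tameP; split.
    by move=> s; rewrite rmorphM /= ff fg.
  by exists (c * d); rewrite fps_coefM big_ord1 fc gd rmorphM.
Qed.
HB.instance Definition _ L := GRing.isSubringClosed.Build _ (@tame L) (@tame_subring L).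

Lemma tameC L c : fpsC (gf_emb L c) \in @tame L.
Proof.
by apply/tameP; split=> [g|]; [rewrite fps_mapC gf_act_emb | exists c].
Qed.

Definition const_emb L : {rmorphism K -> fps L} := @fpsC L \o gf_emb L.

(** The base change used when the coefficient field grows and [t] is ramified. *)
Definition enlarge L L' (u : {rmorphism L -> L'}) M : {rmorphism fps L -> fps L'} :=
  @ramify L' M \o fps_map u.

Lemma enlargeC L L' (u : {rmorphism L -> L'}) M c : enlarge u M (fpsC c) = fpsC (u c).
Proof. by rewrite /= fps_mapC ramifyC. Qed.
Lemma enlargeX L L' (u : {rmorphism L -> L'}) M : (0 < M)%N ->
  enlarge u M fpsX = fpsX ^+ M.
Proof. by move=> M0; rewrite /= fps_mapX ramifyX. Qed.

Lemma enlarge_fixed L L' (u : {rmorphism L -> L'}) M f : equivariant u ->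
  fps_fixed f -> fps_fixed (enlarge u M f).
Proof.
move=> [_ eu] ff g; rewrite /= fps_map_ramify; congr (ramify M _).
rewrite -[in RHS](ff g); apply: fpsP => n.
by rewrite !fps_mapE eu.
Qed.

Lemma enlarge_tame L L' (u : {rmorphism L -> L'}) M f : equivariant u ->
  f \in @tame L -> enlarge u M f \in @tame L'.
Proof.
move=> equ /tameP[ff [c fc]]; apply/tameP; split; first exact: enlarge_fixed.
exists c; rewrite -(proj1 equ) -fc; exact: fps_comp0.
Qed.

Definition eval_at (D : comNzRingType) (e0 : {rmorphism K -> D}) (h : D) :
  {rmorphism {poly K} -> D} := horner_eval h \o map_poly e0.

Lemma eval_atC (D : comNzRingType) (e0 : {rmorphism K -> D}) (h : D) c :
  eval_at e0 h c%:P = e0 c.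
Proof. by rewrite /= /horner_eval map_polyC hornerC. Qed.
Lemma eval_atX (D : comNzRingType) (e0 : {rmorphism K -> D}) (h : D) :
  eval_at e0 h 'X = h.
Proof. by rewrite /= /horner_eval map_polyX hornerX. Qed.

Lemma poly_rmorph_eq (D : comNzRingType) (f g : {rmorphism {poly K} -> D}) :
  (forall c, f c%:P = g c%:P) -> f 'X = g 'X -> f =1 g.
Proof.
move=> fgC fgX; elim/poly_ind => [|p c IHp]; first by rewrite !rmorph0.
by rewrite !rmorphD !rmorphM /= IHp fgC fgX.
Qed.

(** With f = e t^m (1 + ...), ramification makes t^m an N-th power, Hensel's lemma
    takes care of the unit 1 + ..., and only the leading coefficient [e] requires
    a larger field.  The root of the unit is fixed because it is the only one
    with constant term 1. *)
Lemma tame_root L (f : fps L) N : (0 < N)%N -> fps_fixed f -> f 0%N = 0 ->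
  exists L' (u : {rmorphism L -> L'}) (v : fps L'),
    [/\ equivariant u, fps_fixed v, v 0%N = 0 & v ^+ N = enlarge u N f].
Proof.
move=> N0 ff f0; have [->|nzf] := eqVneq f 0.
  exists L, idfun, 0; split=> // [g|]; first by rewrite rmorph0.
  by rewrite rmorph0 expr0n gtn_eqF.
have [m [V [Df nzV]]] := fps_ord nzf; set e := V 0%N in nzV.
have m0 : (0 < m)%N.
  by case: m Df => // Df; move: nzV; rewrite /e -f0 Df mul1r eqxx.
have fV : fps_fixed V.
  move=> g; apply: (mulfI (_ : fpsX ^+ m != 0 :> fps L)).
    by apply: contraNneq nzf => Xm0; rewrite Df Xm0 mul0r.
  by rewrite -Df -[in RHS](ff g) Df rmorphM rmorphXn /= fps_mapX.
have fe g : gf_act g e = e by rewrite /e -fps_mapE fV.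
have [L' [u [s [equ fs Ds]]]] := adjoin_root perfect N0 fe.
have nzN : N%:R != 0 :> L.
  by rewrite -(rmorph_nat (gf_emb L)) fmorph_eq0 pnatr_eq0 -lt0n.
pose V1 := fpsC e^-1 * V.
have V10 : V1 0%N = 1 by rewrite fpsCM mulVf.
have [V2 [V20 DV2]] := fps_nth_root N0 nzN V10.
have fV1 : fps_fixed V1 by move=> g; rewrite rmorphM /= fps_mapC fmorphV fe fV.
have fV2 : fps_fixed V2.
  move=> g; apply: (fps_nth_root_inj N0 nzN) => //.
    by rewrite fps_mapE V20 rmorph1.
  by rewrite -rmorphXn /= DV2 fV1.
have DV : V = fpsC e * V1 by rewrite mulrA -rmorphM divff // rmorph1 mul1r.
clearbody V1; exists L', u, (fpsX ^+ m * (fpsC s * enlarge u N V2)); split=> //.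
- move=> g; rewrite !rmorphM rmorphXn /= fps_mapX fps_mapC fs.
  by congr (_ * (_ * _)); exact: (enlarge_fixed N equ fV2 g).
- by rewrite fpsXnM leqn0 gtn_eqF.
rewrite Df DV !rmorphM rmorphXn enlargeX // enlargeC -Ds -DV2 !rmorphXn !exprMn.
by rewrite -!exprM mulnC.
Qed.

(** With [h = c + f], the roots of P(c + s, X) are Puiseux series over K in an
    N-th root of s, and the N-th root [v] of [f] is substituted for it. *)
Theorem tame_splits L (h : fps L) (P : {poly {poly K}}) : h \in @tame L -> P \is monic ->
  exists L' (u : {rmorphism L -> L'}) M (rs : seq (fps L')),
    [/\ equivariant u, (0 < M)%N, {subset rs <= @tame L'}
      & map_poly (eval_at (const_emb L') (enlarge u M h)) P
          = \prod_(r <- rs) ('X - r%:P)].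
Proof.
move=> /tameP[fh [c hc]] mP.
have mP1 : map_poly (eval_at (@fpsC K) (fpsC c + fpsX)) P \is monic by rewrite monic_map.
have [N N0 [ss Dss]] := puiseux mP1.
pose f := h - fpsC (gf_emb L c).
have f0 : f 0%N = 0 by rewrite fps_coefB hc /= subrr.
have ff : fps_fixed f by move=> g; rewrite rmorphB /= fh fps_mapC gf_act_emb.
have [L' [u [v [equ fv v0 Dv]]]] := tame_root N0 ff f0.
pose Phi : {rmorphism fps K -> fps L'} := fps_comp v \o fps_map (gf_emb L').
exists L', u, N, [seq Phi s | s <- ss]; split=> //.
  move=> _ /mapP[s _ ->]; apply/tameP; split.
    move=> g; rewrite /= fps_map_comp fv; congr fps_comp; apply: fpsP => n.
    by rewrite !fps_mapE gf_act_emb.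
  by exists (s 0%N); exact: fps_comp0.
have PhiC d : Phi (fpsC d) = fpsC (gf_emb L' d) by rewrite /= fps_mapC fps_compC.
transitivity (map_poly Phi (\prod_(s <- ss) ('X - s%:P))); last first.
  by rewrite rmorph_prod big_map; apply: eq_bigr => s _; rewrite [LHS]map_polyXsubC.
have PhiX : Phi fpsX = v by rewrite /= fps_mapX fps_compX.
have E1 : Phi (ramify N (fpsC c + fpsX)) = enlarge u N h.
  have -> : ramify N (fpsC c + fpsX) = fpsC c + fpsX ^+ N.
    by rewrite rmorphD /= ramifyC ramifyX.
  rewrite (rmorphD Phi) PhiC.
  by rewrite rmorphXn PhiX Dv rmorphB enlargeC (proj1 equ) addrC subrK.
rewrite -Dss -!map_poly_comp; apply: eq_map_poly.
apply: (@poly_rmorph_eq _ (eval_at (const_emb L') (enlarge u N h))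
  (Phi \o (@ramify K N \o eval_at (@fpsC K) (fpsC c + fpsX)))) => [d|].
  rewrite eval_atC; transitivity (Phi (ramify N (fpsC d))).
    by rewrite ramifyC PhiC.
  by congr (Phi (ramify N _)); rewrite eval_atC.
by rewrite eval_atX -E1; congr (Phi (ramify N _)); rewrite eval_atX.
Qed.
End LocalSplitting.



(** * Continuity of germs *)

Section Continuity.
Local Open Scope classical_set_scope.
Variable K : numClosedFieldType.

Lemma near_box (p : K * K) (Q : K * K -> Prop) : (\forall z \near p, Q z) ->
  exists2 e : K, 0 < e & forall z, `|z.1 - p.1| < e -> `|z.2 - p.2| < e -> Q z.
Proof.
move=> /nbhs_ballP[e /= e0 eQ]; exists e => // z z1 z2; apply: eQ.
by split; rewrite -ball_normE /= distrC.
Qed.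

Lemma box_near (p : K * K) (Q : K * K -> Prop) (e : K) : 0 < e ->
  (forall z, `|z.1 - p.1| < e -> `|z.2 - p.2| < e -> Q z) -> \forall z \near p, Q z.
Proof.
move=> e0 eQ; apply/nbhs_ballP; exists e => //= z [].
by rewrite -!ball_normE /= => z1 z2; apply: eQ; rewrite distrC.
Qed.

Lemma cvgn_bounded (u : nat -> K) : cvgn u ->
  exists2 B : K, 0 < B & forall n, `|u n| <= B.
Proof.
move=> /cvg_seq_bounded [M [Mreal Mb]].
exists (`|M| + 1); first by rewrite ltr_wpDl.
move=> n; apply: Mb => //.
by apply: le_lt_trans (real_ler_norm Mreal) _; rewrite ltrDl.
Qed.

Lemma limit_bound (u : nat -> K) (l a b : K) : u @ \oo --> l ->
  (forall n, `|u n.+1 - a| <= b) -> forall d, 0 < d -> `|l - a| < b + d.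
Proof.
move=> ul ub d d0.
have [n _ nP] : \forall n \near \oo, `|l - u n| < d by move/cvgrPdist_lt: ul; apply.
have -> : l - a = (l - u n.+1) + (u n.+1 - a) by ring.
rewrite addrC; apply: le_lt_trans (ler_normD _ _) _; rewrite ler_ltD ?ub //.
by apply: nP => /=; exact: leqnSn.
Qed.

(** Shrinking the polydisc by the factor [r <= 1] shrinks every term other than the
    constant one by at least [r], so the sum differs from the constant term by at
    most [r * B], where [B] bounds the sums of absolute values. *)
Lemma analytic2_near_const (f : K * K -> K) p : analytic_at2 f p ->
  exists c0 B e : K, [/\ 0 < B, 0 < e & forall z (r : K), 0 < r -> r <= 1 ->
    `|z.1 - p.1| < r * e -> `|z.2 - p.2| < r * e ->
    forall d, 0 < d -> `|f z - c0| < r * B + d].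
Proof.
case=> c /near_box[e e0 eP]; pose rho := e / 2%:R.
have rho0 : 0 < rho by rewrite divr_gt0.
have rhoe : rho < e by rewrite ltr_pdivrMr // ltr_pMr // ltr1n.
have [] := eP (p.1 + rho, p.2 + rho); rewrite /= ?[_ + rho]addrC ?addrK ?gtr0_norm //.
move=> /cvgn_bounded[B B0 Bb] _.
exists (c 0%N 0%N), B, rho; split=> // z r r0 r1 z1 z2 d d0.
have lerho : r * rho <= rho by rewrite ler_piMl // ltW.
have [||_ /limit_bound lim] := eP z.
- by apply: lt_trans z1 _; apply: le_lt_trans rhoe.
- by apply: lt_trans z2 _; apply: le_lt_trans rhoe.
apply: lim => // n.
pose t (i j : nat) := if (i == 0%N) && (j == 0%N) then c 0%N 0%N else 0.
have -> : c 0%N 0%N = \sum_(i < n.+1) \sum_(j < n.+1) t i j.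
  rewrite big_ord_recl [X in _ + X]big1 ?addr0 => [|i _]; last by apply: big1.
  by rewrite big_ord_recl big1 ?addr0.
rewrite -sumrB; apply: le_trans (ler_norm_sum _ _ _) _.
apply: (@le_trans _ _ (r * \sum_(i < n.+1) \sum_(j < n.+1)
    `|c i j * rho ^+ i * rho ^+ j|)); last first.
  apply: ler_wpM2l; first exact: ltW.
  have := Bb n.+1; rewrite /= ger0_norm //; apply: sumr_ge0 => i _.
  by apply: sumr_ge0 => j _; exact: normr_ge0.
rewrite mulr_sumr; apply: ler_sum => i _; rewrite -sumrB.
apply: le_trans (ler_norm_sum _ _ _) _; rewrite mulr_sumr; apply: ler_sum => j _.
rewrite /t; case: ifP => [/andP[/eqP-> /eqP->]|ij].
  by rewrite !expr0 !mulr1 subrr normr0 mulr_ge0 // ltW.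
rewrite subr0 !normrM !normrX (gtr0_norm rho0).
have le1 : `|z.1 - p.1| ^+ i <= r ^+ i * rho ^+ i.
  by rewrite -exprMn lerXn2r ?nnegrE ?normr_ge0 // ?mulr_ge0 ?ltW.
have le2 : `|z.2 - p.2| ^+ j <= r ^+ j * rho ^+ j.
  by rewrite -exprMn lerXn2r ?nnegrE ?normr_ge0 // ?mulr_ge0 ?ltW.
apply: (@le_trans _ _ (`|c i j| * (r ^+ i * rho ^+ i) * (r ^+ j * rho ^+ j))).
  apply: ler_pM; rewrite ?mulr_ge0 ?exprn_ge0 ?normr_ge0 //.
  by apply: ler_wpM2l.
have -> : `|c i j| * (r ^+ i * rho ^+ i) * (r ^+ j * rho ^+ j) =
    r ^+ (i + j) * (`|c i j| * rho ^+ i * rho ^+ j) by rewrite exprD; ring.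
apply: ler_wpM2r; first by rewrite !mulr_ge0 ?exprn_ge0 ?normr_ge0 // ltW.
have: (0 < i + j)%N by rewrite lt0n addn_eq0 ij.
case: (i + j)%N => // m _; rewrite exprS; apply: ler_piMr; first exact: ltW.
by apply: exprn_ile1 => //; exact: ltW.
Qed.

Lemma analytic2_continuous (f : K * K -> K) p (Q : K -> Prop) : analytic_at2 f p ->
  (\forall t \near f p, Q t) -> \forall z \near p, Q (f z).
Proof.
move=> /analytic2_near_const[c [B [e [B0 e0 cP]]]] /nbhs_ballP[h /= h0 hQ].
(* chosen so that r <= 1 and r * B <= h / 4 *)
pose r := h / (h + 4%:R * B).
have den0 : 0 < h + 4%:R * B by rewrite addr_gt0 // mulr_gt0.
have r0 : 0 < r by rewrite divr_gt0.
have r1 : r <= 1 by rewrite ler_pdivrMr // mul1r lerDl mulr_ge0 // ltW.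
have rB : r * B <= h / 4%:R.
  rewrite /r mulrAC ler_pdivrMr // mulrDr mulrA divfK ?pnatr_eq0 //.
  by rewrite lerDr mulr_ge0 ?divr_ge0 // ltW.
have d0 : 0 < h / 4%:R by rewrite divr_gt0.
apply: (@box_near _ _ (r * e)); first by rewrite mulr_gt0.
move=> z z1 z2; apply: hQ; rewrite -ball_normE /=.
have Dz := cP z r r0 r1 z1 z2 _ d0.
have Dp : `|f p - c| < r * B + h / 4%:R.
  by apply: (cP p r) => //; rewrite subrr normr0 mulr_gt0.
have -> : f p - f z = (f p - c) - (f z - c) by ring.
apply: le_lt_trans (ler_normB _ _) _.
apply: lt_le_trans (ltrD Dp Dz) _.
apply: (@le_trans _ _ ((h / 4%:R + h / 4%:R) + (h / 4%:R + h / 4%:R))).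
  by rewrite !lerD.
by rewrite le_eqVlt; apply/orP; left; apply/eqP; field.
Qed.
End Continuity.

(** * Germs built from entire algebraic functions *)

(** A program is a sequence of relations P_m(h_m, X) = 0, where h_m is a polynomial
    in the preceding variables and P_m is monic over K[t].  Sums and products are
    included, with P = X - t. *)
Section Program.
Variable K : numClosedFieldType.
Variables (h : forall m, ip K m.+1) (P : nat -> {poly {poly K}}).
Hypothesis mP : forall m, P m \is monic.

Definition step_relation m : {poly ip K m.+1} :=
  map_poly (eval_at (ip_const K m.+1) (h m)) (P m).

Lemma step_relation_monic m : step_relation m \is monic.
Proof. by rewrite monic_map. Qed.

Lemma map_step_relation (D : comNzRingType) (e0 : {rmorphism K -> D}) env m :
  map_poly (ev e0 env m.+1) (step_relation m) =
    map_poly (eval_at e0 (ev e0 env m.+1 (h m))) (P m).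
Proof.
rewrite /step_relation -map_poly_comp; apply: eq_map_poly.
apply: (@poly_rmorph_eq K D (ev e0 env m.+1 \o eval_at (ip_const K m.+1) (h m))
  (eval_at e0 (ev e0 env m.+1 (h m)))) => [c|].
  by rewrite eval_atC -(ev_const e0 env m.+1) -(eval_atC (ip_const K m.+1) (h m)).
by rewrite eval_atX; congr (ev e0 env m.+1 _); rewrite eval_atX.
Qed.

Variables (gT : finGroupType) (L0 : gfield K gT) (x0 : L0).
Hypothesis perfect : ([~: [set: gT], [set: gT]] = [set: gT])%g.
Hypothesis fx0 : forall g, gf_act g x0 = x0.

(** Solvability in tame series along a = t^4, b = x t^5, where t is the M-th power
    of the variable of the series. *)
Definition solvable_over k (Q : ip K (k + 1).+1) :=
  exists (L : gfield K gT) (u : {rmorphism L0 -> L}) (M : nat) (env : nat -> fps L),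
  [/\ equivariant u, (0 < M)%N, forall j, env j \in @tame K gT L,
     env 0%N = fpsX ^+ (4 * M) /\ env 1%N = fpsC (u x0) * fpsX ^+ (5 * M)
     & ev (const_emb L) env (k + 1).+1 Q = 0].

(** Each step enlarges the field and ramifies so that the next relation splits;
    [norm_resultant_splits] then selects a root that keeps the equation solvable. *)
Lemma program_solvable k (Q : ip K (k + 1).+1) :
  @eliminate K 1 step_relation k Q = 0 -> @solvable_over k Q.
Proof.
move=> Q0; apply: (@eliminate_ind K 1 step_relation solvable_over); last first.
  exists L0, idfun, 1%N, (fun j => if j == 0%N then fpsX ^+ 4
     else if j == 1%N then fpsC x0 * fpsX ^+ 5 else 0); split=> //.
    move=> j; case: ifP => _; last case: ifP => _; last exact: rpred0.
      apply/tameP; split=> [g|]; first by rewrite rmorphXn /= fps_mapX.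
      by exists 0; rewrite fpsXn rmorph0.
    apply/tameP; split=> [g|]; first by rewrite rmorphM rmorphXn /= fps_mapX fps_mapC fx0.
    by exists 0; rewrite fpsCM fpsXn mulr0 rmorph0.
  by rewrite Q0 rmorph0.
move=> {k Q Q0} k Q [L [u [M [env [equ M0 tenv [env0 env1] NQ0]]]]].
pose n := (k + 1)%N.
have tH : ev (const_emb L) env n.+1 (h n) \in @tame K gT L.
  by apply: ev_closed => [c|j _]; [exact: tameC | exact: tenv].
have [L' [u' [M' [rs [equ' M'0 trs Drs]]]]] := tame_splits perfect tH (mP n).
pose env' := enlarge u' M' \o env.
have evE T : ev (const_emb L') env' n.+1 T = enlarge u' M' (ev (const_emb L) env n.+1 T).
  symmetry; apply: ev_map => c; rewrite enlargeC.
  by rewrite (proj1 equ').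
have Rs : map_poly (ev (const_emb L') env' n.+1) (step_relation n) =
    \prod_(r <- rs) ('X - r%:P) by rewrite map_step_relation evE.
have N0 : ev (const_emb L') env' n.+1 (norm_resultant (step_relation n) Q) = 0.
  by rewrite evE NQ0 rmorph0.
have [r rs_r rQ] := norm_resultant_splits (step_relation_monic n) Rs N0.
exists L', (u' \o u), (M * M')%N, (fun m => if m == n.+1 then r else env' m); split.
- case: equ equ' => [e1 a1] [e2 a2]; split=> [c|g y] /=; first by rewrite e1 e2.
  by rewrite a1 a2.
- by rewrite muln_gt0 M0.
- move=> j; case: ifP => _; first exact: trs.
  by apply: enlarge_tame.
- rewrite /n addn1 /= /env' /comp env0 env1 rmorphM !rmorphXn enlargeX // enlargeC.
  by rewrite -!exprM ![(M' * _)%N]mulnC !mulnA.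
transitivity ((map_poly (ev (const_emb L') env' n.+1) Q).[r]); last exact/eqP.
rewrite [LHS]evS; congr (_.[_]); last by rewrite /= eqxx.
by apply: eq_map_poly => q; apply: ev_eq => m ltm; rewrite /= ltn_eqF.
Qed.
End Program.

(** Comparing orders shows that y is divisible by t, where t is the M-th power of
    the variable; the constant term of y / t is the root looked for. *)
Lemma quintic_unsolvable (K : numClosedFieldType) (gT : finGroupType) (L : gfield K gT)
    (x : L) M (y : fps L) : x != 0 -> (0 < M)%N ->
    fps_fixed y -> y ^+ 5 + fpsX ^+ (4 * M) * y + fpsC x * fpsX ^+ (5 * M) = 0 ->
  exists v : L, (forall g, gf_act g v = v) /\ root (quintic x) v.
Proof.
move=> nzx M0 fy E.
have nzy : y != 0.
  apply/eqP => y0; move: E; rewrite y0 expr0n /= mulr0 !add0r.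
  move/(congr1 (fun f : fps L => f (5 * M)%N)).
  by rewrite fpsCM fpsXn eqxx mulr1 => /eqP; rewrite (negPf nzx).
have [m [V [Dy nzV]]] := fps_ord nzy.
(* if m < M, then y^5 is the only term of order 5 m *)
have leMm : (M <= m)%N.
  rewrite leqNgt; apply/negP => ltmM.
  move: E; rewrite Dy exprMn -exprM [_ * (fpsX ^+ m * V)]mulrA -exprD [fpsC x * _]mulrC.
  move/(congr1 (fun f : fps L => f (m * 5)%N)).
  have c1 : (4 * M + m <= m * 5)%N = false.
    by apply/negbTE; rewrite -ltnNge mulnC mulSnr ltn_add2r ltn_pmul2l.
  have c2 : (5 * M <= m * 5)%N = false.
    by apply/negbTE; rewrite -ltnNge mulnC ltn_pmul2l.
  rewrite !fps_coefD !fpsXnM leqnn subnn c1 c2.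
  rewrite !addr0 => /eqP.
  by rewrite -[_ 0%N]/(fps_const _) rmorphXn expf_eq0 /= (negPf nzV).
pose W := fpsX ^+ (m - M) * V.
have DyW : y = fpsX ^+ M * W by rewrite mulrA -exprD subnKC.
clearbody W; have WE : W ^+ 5 + W + fpsC x = 0.
  apply: (mulfI (_ : fpsX ^+ (5 * M) != 0 :> fps L)).
    apply/eqP => /(congr1 (fun f : fps L => f (5 * M)%N)) /eqP.
    by rewrite fpsXn eqxx oner_eq0.
  rewrite mulr0 -[RHS]E DyW exprMn -exprM [(M * 5)%N]mulnC.
  rewrite [_ * (fpsX ^+ M * W)]mulrA -exprD.
  by rewrite -mulSnr; ring.
exists (W 0%N); split=> [g|].
  have -> : W 0%N = y M by rewrite DyW fpsXnM leqnn subnn.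
  by rewrite -fps_mapE fy.
rewrite rootE horner_quintic -[W 0%N]/(fps_const W) -[x]/(fps_const (fpsC x)).
by rewrite -rmorphXn -!rmorphD WE rmorph0.
Qed.

Section Main.
Local Open Scope classical_set_scope.
Variable K : numClosedFieldType.

Lemma poly2_eq0_near (p : K * K) (Q : {poly {poly K}}) :
  (\forall z \near p, (map_poly (horner_eval z.1) Q).[z.2] = 0) -> Q = 0.
Proof.
move=> /near_box[e e0 eQ]; apply: contrapT => /eqP nzQ.
pose s (a : K) n := a + e / n.+2%:R.
have s_inj a : injective (s a).
  move=> m n /addrI /(mulfI (lt0r_neq0 e0)) /invr_inj /eqP.
  by rewrite eqr_nat => /eqP[].
have s_near a n : `|s a n - a| < e.
  rewrite /s addrC addKr gtr0_norm ?divr_gt0 ?ltr0n //.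
  by rewrite ltr_pdivrMr ?ltr0n // ltr_pMr // ltr1n.
have [i nzi] : exists i, Q`_i != 0.
  by exists (size Q).-1; rewrite -lead_coefE lead_coef_eq0.
have [m nzm] := exists_nonroot (s_inj p.1) nzi.
have nzQm : map_poly (horner_eval (s p.1 m)) Q != 0.
  by apply: contraNneq nzm => Q0; rewrite -[_.[_]]/(horner_eval _ _) -coef_map Q0 coef0.
have [n nzn] := exists_nonroot (s_inj p.2) nzQm.
by case/eqP: nzn; apply: (eQ (s p.1 m, s p.2 n)); rewrite /= s_near.
Qed.

Definition values k (g : 'I_k.+1 -> K * K -> K) (z : K * K) (n : nat) : K :=
  if n is m.+2 then g (inord m) z else if n is 0%N then z.1 else z.2.

(** For a composition, the relation for phi holds near g_j(p), and continuity of
    g_j turns it into a relation near p. *)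
Lemma formation_step_relation p k (g : 'I_k.+1 -> K * K -> K) (i : 'I_k.+1) :
    (forall j, analytic_at2 (g j) p) -> formation_step p g i ->
  exists (h : ip K i.+2) (P : {poly {poly K}}), P \is monic /\
    \forall z \near p, root (map_poly
      (eval_at idfun (ev idfun (values g z) i.+2 h)) P) (g i z).
Proof.
move=> ang.
pose I : {poly {poly K}} := 'X - ('X)%:P.
have mI : I \is monic by exact: monicXsubC.
have linear_step (h : ip K i.+2) :
    (\forall z \near p, g i z = ev idfun (values g z) i.+2 h) ->
  exists (h : ip K i.+2) (P : {poly {poly K}}), P \is monic /\
    \forall z \near p, root (map_poly
      (eval_at idfun (ev idfun (values g z) i.+2 h)) P) (g i z).
  move=> gh; exists h, I; split=> //; apply: filterS gh => z ->.
  by rewrite [map_poly _ _]map_polyXsubC root_XsubC eval_atX.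
have var (j : 'I_k.+1) z : (j < i)%N ->
    ev idfun (values g z) i.+2 (ip_var K i.+2 j.+2) = g j z.
  by move=> ji; rewrite ev_var //= inord_val.
case=> [gi|gi|c gi|j l ji li gi|j l ji li gi|j phi ji [_ [P [mP _ Pphi]]] gi].
- apply: (linear_step (ip_var K i.+2 0)); apply: filterS gi => z ->.
  by rewrite ev_var.
- apply: (linear_step (ip_var K i.+2 1)); apply: filterS gi => z ->.
  by rewrite ev_var.
- apply: (linear_step (ip_const K i.+2 c)); apply: filterS gi => z ->.
  by rewrite ev_const.
- apply: (linear_step (ip_var K i.+2 j.+2 + ip_var K i.+2 l.+2)).
  by apply: filterS gi => z ->; rewrite rmorphD !var.
- apply: (linear_step (ip_var K i.+2 j.+2 * ip_var K i.+2 l.+2)).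
  by apply: filterS gi => z ->; rewrite rmorphM !var.
exists (ip_var K i.+2 j.+2), P; split=> //.
have near_phi := analytic2_continuous (ang j) Pphi.
apply: filterS2 gi near_phi => z -> Pz; rewrite var //; apply/rootP.
have eval_id (q : {poly K}) t : eval_at idfun t q = q.[t].
  by rewrite /= /horner_eval map_poly_id.
by rewrite -[RHS]Pz -eval_id -horner_map eval_atC.
Qed.

Theorem quintic_not_expressible :
  ~ expressible_by_entire_algebraic (@germ_of_quintic_root K).
Proof.
case=> p [k [g [ang stg [_ quint]]]].
have step m : exists hP : ip K m.+1 * {poly {poly K}}, hP.2 \is monic /\
    forall i : 'I_k.+1, m = i.+1 -> \forall z \near p, root (map_poly
      (eval_at idfun (ev idfun (values g z) m.+1 hP.1)) hP.2) (g i z).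
  (* the variables of index m.+1 with m = 0 or m > k.+1 are not germs, and get
     the relation X = 0 as a default *)
  case: m => [|m]; first by exists (0, 'X); split=> //; exact: monicX.
  have [ltmk|lekm] := ltnP m k.+1; last first.
    exists (0, 'X); split=> [|i [Dm]]; first exact: monicX.
    by have := ltn_ord i; rewrite -Dm ltnNge lekm.
  have [h [P [mP hP]]] := formation_step_relation ang (stg (Ordinal ltmk)).
  exists (h, P); split=> // i [Dm].
  have -> : i = Ordinal ltmk by apply: val_inj.
  exact: hP.
pose h m := (projT1 (cid (step m))).1; pose P m := (projT1 (cid (step m))).2.
have mP m : P m \is monic by have [] := projT2 (cid (step m)).
have hP (i : 'I_k.+1) : \forall z \near p, root (map_poly (ev idfun (values g z) i.+2)
    (step_relation h P i.+1)) (g i z).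
  have [_ /(_ i erefl)] := projT2 (cid (step i.+1)).
  by apply: filterS => z; rewrite map_step_relation.
pose n := (k.+1 + 1).+1.
pose y := ip_var K n k.+2.
pose Q : ip K n := y ^+ 5 + ip_var K n 0 * y + ip_var K n 1.
have evQ (D : comNzRingType) (e0 : {rmorphism K -> D}) env :
    ev e0 env n Q = env k.+2 ^+ 5 + env 0%N * env k.+2 + env 1%N.
  by rewrite !rmorphD rmorphXn rmorphM /y !ev_var // /n addn1.
have N0 : @eliminate K 1 (step_relation h P) k.+1 Q = 0.
  have hPall : \forall z \near p, forall i : 'I_k.+1, root (map_poly
      (ev idfun (values g z) i.+2) (step_relation h P i.+1)) (g i z).
    exact: (@filter_forall _ _ (fun (i : 'I_k.+1) z => is_true (root (map_poly
      (ev idfun (values g z) i.+2) (step_relation h P i.+1)) (g i z))) (nbhs p) _ hP).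
  apply: (@poly2_eq0_near p).
  apply: filterS2 hPall quint => z rz qz.
  transitivity (ev idfun (values g z) 2 (@eliminate K 1 (step_relation h P) k.+1 Q)).
    rewrite [RHS]evS; congr (_.[_]); apply: eq_map_poly => q.
    by rewrite [RHS]evS map_poly_id.
  apply: (@eliminate_root K 1 (step_relation h P) _ K idfun (values g z) k.+1 Q)
    => [m|i ltik|]; first exact: step_relation_monic.
    have := rz (inord i); rewrite inordK // addn1 => rzi.
    exact: rzi.
  rewrite [LHS]evQ -qz /values.
  by have -> : inord k = ord_max :> 'I_k.+1 by apply: val_inj; rewrite /= inordK.
have [gT [L0 [x0 [w [perfect [fx0 nzx0 wE moved]]]]]] := quintic_gfield K.
have [L [u [M [env [equ M0 tenv [env0 env1] sol]]]]] :=
  program_solvable mP perfect fx0 N0.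
rewrite evQ env0 env1 in sol.
have /tameP[fy _] := tenv k.+2.
have nzux : u x0 != 0 by rewrite fmorph_eq0.
have [v [fv rv]] := quintic_unsolvable nzux M0 fy sol.
have uwE : quintic (u x0) = \prod_i ('X - (u (w i))%:P).
  rewrite -map_quintic wE rmorph_prod; apply: eq_bigr => i _.
  by rewrite [LHS]map_polyXsubC.
have [i Dv] := quintic_root_branch uwE rv.
have [s /eqP] := moved i; apply; apply: (fmorph_inj u).
by rewrite (proj2 equ) -Dv fv.
Qed.
End Main.

Theorem corollary19 (R : realType) :
  ~ expressible_by_entire_algebraic (@germ_of_quintic_root R[i]%C).
Proof. exact: quintic_not_expressible. Qed.
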